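(* Let $\Lambda$ be a nice Fitting order. Then $$\mathcal{U}(\Lambda) = \mathcal{I}(\Lambda) = \mathcal{H}(\Lambda) = \zeta(\Lambda).$$
   Context: $\zeta(\cdot)$ denotes the centre of a ring. A Fitting domain is an integrally closed complete commutative noetherian local domain $\mathfrak{o}$; let $F$ be its field of quotients. A Fitting order over $\mathfrak{o}$ is an $\mathfrak{o}$-order $\Lambda$ in a (finite dimensional) separable $F$-algebra $A$. A Fitting order $\Lambda$ over $\mathfrak{o}$ is nice if $\Lambda = \bigoplus_{j=1}^k \Lambda_j$ where each $\Lambda_j$ is either a maximal $\mathfrak{o}$-order or of the form $M_{a_j\times a_j}(\Gamma_j)$ for some commutative ring $\Gamma_j$. Let $e_1,\dots,e_t$ be the central primitive idempotents of $A$, $A_i = Ae_i \simeq M_{n_i\times n_i}(D_i)$ with $D_i$ a skewfield, $F_i = \zeta(A_i)=\zeta(D_i)$, $[D_i:F_i]=s_i^2$. The reduced norm $\mathrm{nr}: M_{b\times b}(A)\to \zeta(A) = \bigoplus_i F_i$ is defined componentwise. Put $$\mathcal{U}(\Lambda) := \langle \mathrm{nr}(H)\mid H\in \mathrm{GL}_b(\Lambda), b\in\mathbb{N}\rangle_{\zeta(\Lambda)},\quad \mathcal{I}(\Lambda) := \langle \mathrm{nr}(H)\mid H\in M_{b\times b}(\Lambda), b\in\mathbb{N}\rangle_{\zeta(\Lambda)}$$ ($\zeta(\Lambda)$-submodules of $\zeta(A)$). Generalised adjoint: for $H\in M_{b\times b}(\Lambda)$ put $H_i = He_i$, $m_i =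 n_i s_i b$, let $f_i(X)=\sum_{j=0}^{m_i}\alpha_{ij}X^j$ be the reduced characteristic polynomial of $H_i$ (over $F_i$), and set $H_i^{\ast} := (-1)^{m_i+1}\sum_{j=1}^{m_i}\alpha_{ij}H_i^{j-1}$ (with $H_i^0$ the identity of $M_{b\times b}(A_i)$), $H^{\ast} := \sum_{i=1}^t H_i^{\ast}$; then $H^\ast H = HH^\ast = \mathrm{nr}(H)\cdot 1_{b\times b}$. Put $$\mathcal{H}(\Lambda) := \{x\in\zeta(\Lambda)\mid xH^{\ast}\in M_{b\times b}(\Lambda)\ \text{for all } H\in M_{b\times b}(\Lambda) \text{ and all } b\in\mathbb{N}\}.$$ *)

(* Defs.v *)
From HB Require Import structures.
From mathcomp Require Import all_boot all_order all_algebra all_field.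
From mathcomp Require Import boolp classical_sets functions cardinality fsbigop.

Set Implicit Arguments.
Unset Strict Implicit.
Unset Printing Implicit Defensive.
Import GRing.Theory.
Local Open Scope classical_set_scope.
Local Open Scope ring_scope.

(* Finite sums of products c * s with c in C and s in S. *)
Definition mspan (R : pzRingType) (C S : set R) : set R :=
  [set x | exists (n : nat) (c s : 'I_n -> R),
     [/\ forall k, C (c k), forall k, S (s k) & x = \sum_(k < n) c k * s k]].

(** Fitting domains *)

Definition is_ideal (o : comNzRingType) (I : set o) : Prop :=
  [/\ I 0, forall x y, I x -> I y -> I (x + y) & forall a x, I x -> I (a * x)].

Definition maximal_ideal (o : comNzRingType) (m : set o) : Prop :=
  [/\ is_ideal m, ~ m 1 &
      forall I : set o, is_ideal I -> m `<=` I -> ~ I 1 -> I = m].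

Definition noetherian (o : comNzRingType) : Prop :=
  forall I : set o, is_ideal I ->
    exists S : set o, finite_set S /\ I = mspan setT S.

Definition ideal_pow (o : comNzRingType) (m : set o) (n : nat) : set o :=
  iter n (mspan m) setT.

(* Completeness in the I-adic topology includes separatedness. *)
Definition adically_complete (o : comNzRingType) (I : set o) : Prop :=
  (forall x : o, (forall n, ideal_pow I n x) -> x = 0) /\
  (forall u : nat -> o,
     (forall n, exists N, forall p q, (N <= p)%N -> (N <= q)%N ->
        ideal_pow I n (u p - u q)) ->
     exists l : o, forall n, exists N, forall p, (N <= p)%N ->
        ideal_pow I n (u p - l)).

Definition complete_local (o : comNzRingType) : Prop :=
  exists m : set o,
    [/\ maximal_ideal m, forall m', maximal_ideal m' -> m' = m
      & adically_complete m].

Definition integrally_closed (o : idomainType) : Prop :=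
  forall z : {fraction o}, integralOver (@tofrac o) z -> exists x : o, z = tofrac x.

Definition fitting_domain (o : idomainType) : Prop :=
  [/\ integrally_closed o, noetherian o & complete_local o].

(** Centres, central idempotents and corner rings *)

Definition zeta (R : pzRingType) (L : set R) : set R :=
  [set x | L x /\ forall y, L y -> x * y = y * x].

Definition central_idempotent (R : pzRingType) (e : R) : Prop :=
  e * e = e /\ forall x, e * x = x * e.

Definition central_primitive_idempotent (R : pzRingType) (e : R) : Prop :=
  [/\ central_idempotent e, e <> 0 &
      forall u v : R, central_idempotent u -> central_idempotent v ->
        u * v = 0 -> e = u + v -> u = 0 \/ v = 0].

(* For e a central idempotent, corner L e = L e is a ring with identity e
   whenever L is a subring containing 1. *)
Definition corner (R : pzRingType) (L : set R) (e : R) : set R :=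
  [set x * e | x in L].

(** Separable algebras: semisimple, and the centre of each simple component
    is a separable field extension of the base field *)

Definition left_ideal (F : fieldType) (A : falgType F) (W : {vspace A}) : Prop :=
  ({: A} * W <= W)%VS.

Definition semisimple_algebra (F : fieldType) (A : falgType F) : Prop :=
  forall W : {vspace A}, left_ideal W ->
    exists W' : {vspace A},
      [/\ left_ideal W', (W + W')%VS = fullv & (W :&: W')%VS = 0%VS].

(* The polynomial p is evaluated in the F-algebra A e, whose identity is e. *)
Definition separable_algebra (F : fieldType) (A : falgType F) : Prop :=
  semisimple_algebra A /\
  forall e : A, central_primitive_idempotent e ->
  forall x : A, zeta (corner setT e) x ->
    exists p : {poly F},
      [/\ irreducible_poly p, separable_poly p & horner_alg x p * e = 0].

(** Orders *)

(* L is an o-order in the F-algebra A e with identity e, where e is a central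
   idempotent of A and F = Frac o. *)
Definition is_order (o : idomainType) (A : falgType {fraction o})
    (e : A) (L : set A) : Prop :=
  [/\ L `<=` corner setT e,
      [/\ L e, forall x y, L x -> L y -> L (x - y)
        & forall x y, L x -> L y -> L (x * y)],
      exists S : set A, finite_set S /\
        L = mspan (range (fun c : o => (tofrac c)%:A)) S
    & corner setT e = mspan (range (fun c : {fraction o} => c%:A)) L].

Definition maximal_order (o : idomainType) (A : falgType {fraction o})
    (e : A) (L : set A) : Prop :=
  is_order e L /\
  forall L' : set A, is_order e L' -> L `<=` L' -> L' = L.

Definition is_matrix_ring (R : pzRingType) (L : set R) : Prop :=
  exists (G : comPzRingType) (a : nat) (psi : {additive 'M[G]_a -> R}),
    [/\ (0 < a)%N, injective psi,
        forall X Y, psi (X *m Y) = psi X * psi Y & L = range psi].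

Definition fitting_order (o : idomainType) (A : falgType {fraction o})
    (L : set A) : Prop :=
  [/\ fitting_domain o, separable_algebra A & is_order 1 L].

(* A decomposition of the ring L as a direct sum of rings L_j is given by
   orthogonal central idempotents eps_j of L with sum 1, L_j = L eps_j. *)
Definition nice (o : idomainType) (A : falgType {fraction o})
    (L : set A) : Prop :=
  fitting_order L /\
  exists (k : nat) (eps : 'I_k -> A),
    [/\ forall j, zeta L (eps j) /\ eps j * eps j = eps j,
        forall i j, i != j -> eps i * eps j = 0,
        \sum_(j < k) eps j = 1
      & forall j, maximal_order (eps j) (corner L (eps j)) \/
                  is_matrix_ring (corner L (eps j))].

(** Reduced characteristic polynomials and reduced norms *)

(* R e is a simple ring with centre K = zeta (R e).  A unital morphism phi from
   R to M_m(E) with phi e = 1 factors through R e; it makes E an extension of K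
   (phi maps K to scalar matrices), and it induces an isomorphism from
   E (x)_K R e to M_m(E) iff it maps a K-basis of R e to an E-basis of M_m(E). *)
Definition splitting (R : pzRingType) (e : R) (E : fieldType) (m : nat)
    (phi : {rmorphism R -> 'M[E]_m}) : Prop :=
  [/\ phi e = 1,
      forall z, zeta (corner setT e) z -> is_scalar_mx (phi z)
    & exists (n : nat) (a : 'I_n -> R),
      [/\ forall k, corner setT e (a k),
          forall x, corner setT e x ->
            exists! c : 'I_n -> R,
              (forall k, zeta (corner setT e) (c k)) /\
              x = \sum_(k < n) c k * a k
        & basis_of {: 'M[E]_m} [seq phi (a k) | k : 'I_n]]].

(* f is the reduced characteristic polynomial of H in M_b(A e), over the field
   F_e = zeta (A e): its coefficients lie in F_e, and it is the characteristic
   polynomial of the image of H under some splitting of M_b(A e). *)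
Definition is_redchar (A : nzRingType) (e : A) (b : nat) (H : 'M[A]_b)
    (f : {poly A}) : Prop :=
  (forall j, zeta (corner setT e) f`_j) /\
  exists (E : fieldType) (m : nat) (phi : {rmorphism 'M[A]_b -> 'M[E]_m}),
    splitting (e%:M : 'M[A]_b) phi /\
    forall j, phi (f`_j)%:M = ((char_poly (phi H))`_j)%:M.

Definition redchar (A : nzRingType) (e : A) (b : nat) (H : 'M[A]_b) :
  {poly A} := xget 0 [set f | is_redchar e H f].

Section GeneralisedAdjoint.
Variables (A : nzRingType) (b : nat).
Implicit Type H : 'M[A]_b.

(* The degree of redchar e is m_i = n_i s_i b for e = e_i. *)
Definition nr_comp (e : A) H : A :=
  let f := redchar e (e *: H) in
  let m := (size f).-1 in
  (-1) ^+ m * f`_0.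

(* Since f`_1 lies in A e, f`_1 *: (e *: H) ^+ 0 is f`_1 times the identity
   e *: 1 of M_b(A e). *)
Definition adjoint_comp (e : A) H : 'M[A]_b :=
  let f := redchar e (e *: H) in
  let m := (size f).-1 in
  (-1) ^+ m.+1 *: \sum_(1 <= j < m.+1) f`_j *: (e *: H) ^+ j.-1.

Definition nr H : A :=
  \sum_(e \in [set e : A | central_primitive_idempotent e]) nr_comp e H.

Definition adjoint H : 'M[A]_b :=
  \sum_(e \in [set e : A | central_primitive_idempotent e]) adjoint_comp e H.

End GeneralisedAdjoint.

Definition mx_over (A : nzRingType) (b : nat) (L : set A) : set 'M[A]_b :=
  [set H | forall i j, L (H i j)].

Definition GL_over (A : nzRingType) (b : nat) (L : set A) : set 'M[A]_b :=
  [set H | mx_over L H /\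
     exists H', [/\ mx_over L H', H *m H' = 1%:M & H' *m H = 1%:M]].

Definition calU (A : nzRingType) (L : set A) : set A :=
  mspan (zeta L)
    [set x | exists (b : nat) (H : 'M[A]_b),
       [/\ (0 < b)%N, GL_over L H & x = nr H]].

Definition calI (A : nzRingType) (L : set A) : set A :=
  mspan (zeta L)
    [set x | exists (b : nat) (H : 'M[A]_b),
       [/\ (0 < b)%N, mx_over L H & x = nr H]].

Definition calH (A : nzRingType) (L : set A) : set A :=
  [set x | zeta L x /\
     forall (b : nat) (H : 'M[A]_b), (0 < b)%N ->
       mx_over L H -> mx_over L (x *: adjoint H)].

(* Main.v *)
(** Cut the nice order by its central idempotents [eps_j]. If [eps_j L] is a
    maximal order, the coefficients of a reduced characteristic polynomial of a
    matrix over it are integral over [o] and central, so that adjoining one of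
    them to [eps_j L] gives an order again: they lie in [eps_j L]. If
    [eps_j L = M_a(G)] with [G] commutative, any splitting of a simple component
    [e] below [eps_j] turns the matrix units of [M_(ba)(G)] into those of the
    split algebra, so that the reduced characteristic polynomial at [e] is [e]
    times the ordinary one over [G]; summing over the [e] below [eps_j] gives
    elements of [eps_j L]. Hence [nr H] is in [zeta L] and [adjoint H] is a matrix
    over [L]; with [nr 1 = 1] all four modules coincide. As [nr] is a junk value
    without a splitting, splittings of [M_b(A e)] have to be constructed: they are
    the representations of minimal dimension over all fields. *)

From HB Require Import structures.
Require Import Defs.
From mathcomp Require Import all_boot all_order all_algebra all_field.
From mathcomp Require Import boolp classical_sets cardinality fsbigop.

Set Implicit Arguments.
Unset Strict Implicit.
Unset Printing Implicit Defensive.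
Import GRing.Theory VectorInternalTheory.
Local Open Scope ring_scope.

(** * Representations over varying fields *)

(** Two obstacles shape the proof. The identity of [A e] is not that of [A], so simplicity,
    representations and density are stated for a ring [R] with a central idempotent [e]; a unital
    [phi] on [R] with [phi e = 1] stands for a representation of [R e]. And no splitting field of
    [A e] is given. A representation of least dimension among all fields keeps this property, hence
    irreducibility, under every extension of scalars. Adjoining eigenvalues therefore lowers the
    rank of a nonzero element in the span of the image down to 1, and irreducibility then makes that
    span the whole matrix algebra. That elements irredundant over the centre stay independent over
    the splitting field is the density theorem for two-sided multiplications. As [redchar] is a
    choice, the splitting behind it is unknown: characteristic polynomials are computed for an
    arbitrary splitting, and their coefficients are compared in [A e], on which every splitting is
    injective. *)

Lemma rmorphism_exists (R S : pzRingType) (f : R -> S) :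
  zmod_morphism f -> monoid_morphism f ->
  exists g : {rmorphism R -> S}, g =1 f.
Proof.
move=> fB fM.
pose mB := GRing.isZmodMorphism.Build R S f fB.
pose mM := GRing.isMonoidMorphism.Build R S f fM.
pose g : {rmorphism R -> S} := HB.pack f mB mM.
by exists g.
Qed.

Lemma irreducible_factor (F : fieldType) (p : {poly F}) :
  (1 < size p)%N -> exists q, irreducible_poly q /\ (q %| p)%R.
Proof.
have [n] := ubnP (size p); elim: n p => // n IH p ltpn p1.
have [irr|nirr] := pselect (irreducible_poly p).
  by exists p; split.
have [q [q1 qp qNp]] : exists q : {poly F}, [/\ size q != 1%N, (q %| p)%R & ~~ (q %= p)%R].
  apply: contrapT => H; apply: nirr; split=> // q q1 qp.
  by apply: contrapT => qNp; apply: H; exists q; split=> //; apply/negP.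
have p0 : p != 0 by rewrite -size_poly_gt0 (ltn_trans _ p1).
have ltqp : (size q < size p)%N.
  rewrite ltn_neqAle dvdp_leq // andbT.
  by apply: contra qNp => /eqP eqs; rewrite -(dvdp_size_eqp qp) eqs.
have q1' : (1 < size q)%N.
  have q0 : q != 0 by apply: contraTneq qp => ->; rewrite dvd0p.
  by case: (size q) (size_poly_gt0 q) q1 => [|[|]] //; rewrite q0.
have [r [irr rq]] := IH q (leq_trans ltqp ltpn) q1'.
by exists r; split=> //; apply: dvdp_trans qp.
Qed.

(** This replaces an algebraic closure: fields grow by one root at a time. *)
Lemma root_extension (F : fieldType) (p : {poly F}) : (1 < size p)%N ->
  exists (E : fieldType) (iota : {rmorphism F -> E}) (x : E),
    root (map_poly iota p) x.
Proof.
move=> /irreducible_factor [q [irr qp]].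
have [L _ [z qz _]] := irredp_FAdjoin irr.
exists L, (in_alg L), z.
by have /dvdpP [r ->] := qp; rewrite rmorphM rootM qz orbT.
Qed.

Section Representations.
Variable R : pzRingType.

(** The image of [phi] is only a subring, since [R] carries no action of [E]; its [E]-span is a
    subalgebra of the matrix algebra. *)
Inductive espan (E : fieldType) (m : nat) (phi : R -> 'M[E]_m) :
    'M[E]_m -> Prop :=
| espan_im r : espan phi (phi r)
| espanZ c M : espan phi M -> espan phi (c *: M)
| espanD M N : espan phi M -> espan phi N -> espan phi (M + N).

Lemma espanM (E : fieldType) m (phi : {rmorphism R -> 'M[E]_m}) M N :
  espan phi M -> espan phi N -> espan phi (M *m N).
Proof.
elim=> [r|c M' _ IH|M1 M2 _ IH1 _ IH2] spN; last 1 first.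
- by rewrite mulmxDl; apply: espanD; [apply: IH1|apply: IH2].
- elim: spN => [s|c N' _ IH|N1 N2 _ IH1 _ IH2].
  + by have := espan_im phi (r * s); rewrite rmorphM.
  + by rewrite -scalemxAr; apply: espanZ.
  + by rewrite mulmxDr; apply: espanD.
- by rewrite -scalemxAl; apply/espanZ/IH.
Qed.

Lemma espan0 (E : fieldType) m (phi : {rmorphism R -> 'M[E]_m}) : espan phi 0.
Proof. by rewrite -(rmorph0 phi); apply: espan_im. Qed.

Lemma espan1 (E : fieldType) m (phi : {rmorphism R -> 'M[E]_m}) :
  espan phi 1%:M.
Proof. by have := espan_im phi 1; rewrite rmorph1. Qed.

Lemma espan_stable (E : fieldType) m (phi : {rmorphism R -> 'M[E]_m})
    k (W : 'M_(k, m)) :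
  (forall r, (W *m phi r <= W)%MS) -> forall M, espan phi M -> (W *m M <= W)%MS.
Proof.
move=> stW M; elim=> [r|c N _ IH|N P _ IH1 _ IH2]; first exact: stW.
  by rewrite -scalemxAr scalemx_sub.
by rewrite mulmxDr addmx_sub.
Qed.

Lemma map_espan (E E' : fieldType) (iota : {rmorphism E -> E'}) m
    (phi : {rmorphism R -> 'M[E]_m}) (phi' : {rmorphism R -> 'M[E']_m}) :
  phi' =1 map_mx iota \o phi ->
  forall M, espan phi M -> espan phi' (map_mx iota M).
Proof.
move=> phi'E M; elim=> [r|c N _ IH|N P _ IH1 _ IH2].
- by have := espan_im phi' r; rewrite phi'E.
- by rewrite map_mxZ; apply: espanZ.
- by rewrite map_mxD; apply: espanD.
Qed.

Lemma extend_scalars (E E' : fieldType) (iota : {rmorphism E -> E'}) m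
    (phi : {rmorphism R -> 'M[E]_m}) :
  exists phi' : {rmorphism R -> 'M[E']_m}, phi' =1 map_mx iota \o phi.
Proof.
apply: rmorphism_exists; last split.
- by move=> x y /=; rewrite rmorphB map_mxB.
- by rewrite /= rmorph1 map_mx1.
- by move=> x y /=; rewrite rmorphM map_mxM.
Qed.

(** The action is written in a row basis of [W]. The conclusion is kept for [r = e]: the smaller
    representation still maps [e] to 1. *)
Lemma subrep (E : fieldType) m (phi : {rmorphism R -> 'M[E]_m}) (W : 'M_m) :
  (forall r, (W *m phi r <= W)%MS) ->
  exists phi' : {rmorphism R -> 'M[E]_(\rank W)},
    forall r, W *m phi r = W -> phi' r = 1.
Proof.
move=> stW; have [B [Bfree BW]] : exists B : 'M_(\rank W, m), row_free B /\ (B :=: W)%MS.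
  by exists (row_base W); split; [apply: row_base_free|apply: eq_row_base].
have [C [BC CB]] : exists C, B *m C = 1%:M /\
    forall k (M : 'M_(k, m)), (M <= B)%MS -> M *m C *m B = M.
  by exists (pinvmx B); split=> [|k M]; [apply: mulmxVp|apply: mulmxKpV].
have stB r : (B *m phi r <= B)%MS.
  by rewrite BW (submx_trans (submxMr _ _) (stW r)) ?BW.
have [phi' phi'E] : exists phi' : {rmorphism R -> 'M[E]_(\rank W)},
    phi' =1 fun r => B *m phi r *m C.
  apply: rmorphism_exists; last split.
  - by move=> x y; rewrite rmorphB mulmxBr mulmxBl.
  - by rewrite rmorph1 mulmx1 BC.
  - move=> x y; rewrite rmorphM -[RHS]/((_ *m _) *m (_ *m _)).
    by rewrite !mulmxA CB.
exists phi' => r Wr; rewrite phi'E.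
suff -> : B *m phi r = B by [].
have /submxP [D ->] : (B <= W)%MS by rewrite BW.
by rewrite -mulmxA Wr.
Qed.

End Representations.

(** [W] has the largest rank among the matrices with row space inside [P]; a vector of [P] outside
    it would raise the rank. *)
Lemma rowspaceP (E : fieldType) m (P : 'rV[E]_m -> Prop) :
  P 0 -> (forall c u v, P u -> P v -> P (c *: u + v)) ->
  exists W : 'M[E]_m, forall w, (w <= W)%MS <-> P w.
Proof.
move=> P0 PL.
pose Q r := `[< exists W : 'M[E]_m, (forall w, (w <= W)%MS -> P w) /\ \rank W = r >].
have exQ : exists r, Q r.
  exists 0%N; apply/asboolP; exists 0; rewrite mxrank0; split=> // w.
  by rewrite submx0 => /eqP->.
have Qm r : Q r -> (r <= m)%N by case/asboolP => W [_ <-]; apply: rank_leq_row.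
have [r /asboolP [W [WP rW]] max] := ex_maxnP exQ Qm.
exists W => w; split; first exact: WP.
move=> Pw; have WWw : (W <= W + w)%MS by apply: addsmxSl.
have : (\rank (W + w)%MS <= \rank W)%N.
  rewrite rW; apply: max; apply/asboolP; exists (W + w)%MS; split=> // w'.
  case/sub_addsmxP => -[u v] /= ->.
  rewrite addrC [v]mx11_scalar mul_scalar_mx; apply: PL => //.
  by apply: WP; apply: submxMl.
move=> le; have := mxrank_leqif_eq WWw => -[_].
rewrite eqn_leq (mxrankS WWw) le /= => /esym/andP[_ /(submx_trans _)]; apply.
exact: addsmxSr.
Qed.

(** * Representations of minimal dimension and elements of rank one *)

Section MinimalRepresentation.
Variables (R : pzRingType) (e : R) (m : nat).
Hypothesis m_gt0 : (0 < m)%N.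
Hypothesis min_m : forall (E : fieldType) k (phi : {rmorphism R -> 'M[E]_k}),
  (0 < k)%N -> phi e = 1 -> (m <= k)%N.

Section OneRepresentation.
Variables (E : fieldType) (phi : {rmorphism R -> 'M[E]_m}).
Hypothesis phie : phi e = 1.

(** A proper nonzero stable subspace would carry a representation of smaller positive dimension that
    still maps [e] to 1. *)
Lemma minimal_rep_irreducible (W : 'M[E]_m) :
  (forall r, (W *m phi r <= W)%MS) -> W != 0 -> row_full W.
Proof.
move=> stW W0; have [phi' phi'E] := subrep stW.
rewrite /row_full eqn_leq rank_leq_row (min_m (phi := phi')) ?lt0n ?mxrank_eq0 //.
by apply: phi'E; rewrite phie mulmx1.
Qed.

(** The vectors [v *m M] form a stable subspace containing [v], so it is everything. *)
Lemma minimal_rep_row_transitive (v w : 'rV[E]_m) :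
  v != 0 -> exists M, espan phi M /\ v *m M = w.
Proof.
move=> v0; pose P w := exists M, espan phi M /\ v *m M = w.
have [||W WP] := @rowspaceP _ _ P.
- by exists 0; split; [apply: espan0|rewrite mulmx0].
- move=> c _ _ [M [sM <-]] [N [sN <-]]; exists (c *: M + N); split.
    by apply: espanD => //; apply: espanZ.
  by rewrite mulmxDr -scalemxAr.
apply/WP/submx_full/minimal_rep_irreducible => [r|].
  apply/row_subP => i; rewrite row_mul.
  have [M [sM <-]] : P (row i W) by apply/WP/row_sub.
  apply/WP; exists (M *m phi r); split; last by rewrite mulmxA.
  by apply: espanM => //; apply: espan_im.
have : (v <= W)%MS by apply/WP; exists 1%:M; split; [apply: espan1|rewrite mulmx1].
by apply: contraTneq => ->; rewrite submx0.
Qed.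

(** If the columns [M *m u] did not fill the space, a nonzero row [y] would annihilate all of them;
    but [y] can be moved to the unit row that reads off a nonzero coordinate of [u]. *)
Lemma minimal_rep_col_transitive (u w : 'cV[E]_m) :
  u != 0 -> exists M, espan phi M /\ M *m u = w.
Proof.
move=> u0; pose P w := exists M, espan phi M /\ (M *m u)^T = w.
have [||W WP] := @rowspaceP _ _ P.
- by exists 0; split; [apply: espan0|rewrite mul0mx trmx0].
- move=> c _ _ [M [sM <-]] [N [sN <-]]; exists (c *: M + N); split.
    by apply: espanD => //; apply: espanZ.
  by rewrite mulmxDl -scalemxAl linearP.
suff Wfull : row_full W.
  have /WP [M [sM Mw]] : (w^T <= W)%MS by apply: submx_full.
  by exists M; split=> //; apply: trmx_inj.
apply: contrapT => /negP Wnfull.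
have : kermx W^T != 0 by rewrite kermx_eq0 /row_free mxrank_tr.
case/rowV0Pn => y /sub_kermxP yW y0.
have [i ui] : exists i, u i 0 != 0.
  apply: contrapT => H; case/negP: u0; apply/eqP/matrixP => i j.
  rewrite [j]ord1 mxE; apply: contrapT => /eqP ui; exact: H (ex_intro _ i ui).
have [M [sM yM]] := minimal_rep_row_transitive (delta_mx 0 i) y0.
have /submxP [D DW] : ((M *m u)^T <= W)%MS by apply/WP; exists M.
have : y *m (M *m u) = 0 by rewrite -[M *m u]trmxK DW trmx_mul mulmxA yW mul0mx.
rewrite mulmxA yM => /matrixP/(_ 0 0); rewrite -rowE !mxE => /eqP.
by apply/negP.
Qed.

(** With [T = C *m D] for a column [C] and a row [D], the two transitivities give [M1 *m T *m M2]
    equal to any matrix unit. *)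
Lemma rank1_espan_full T : espan phi T -> \rank T = 1%N -> forall M, espan phi M.
Proof.
move=> sT rT.
have [C [D [C0 [D0 TE]]]] : exists (C : 'cV[E]_m) (D : 'rV[E]_m),
    C != 0 /\ D != 0 /\ T = C *m D.
  move: (col_base T) (row_base T) (mulmx_base T); rewrite rT => C D TE.
  exists C, D; rewrite TE; have : T != 0 by rewrite -mxrank_eq0 rT.
  rewrite -TE; split; last by split=> //; apply: contraNneq H => ->; rewrite mulmx0.
  by apply: contraNneq H => ->; rewrite mul0mx.
move=> M; rewrite [M]matrix_sum_delta.
elim/big_ind: _ => [|? ?|i _]; [exact: espan0|exact: espanD|].
elim/big_ind: _ => [|? ?|j _]; [exact: espan0|exact: espanD|].
apply: espanZ.
have [M1 [s1 M1C]] := minimal_rep_col_transitive (delta_mx i 0) C0.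
have [M2 [s2 DM2]] := minimal_rep_row_transitive (delta_mx 0 j) D0.
rewrite -(mul_delta_mx (0 : 'I_1)) -M1C -DM2 -!mulmxA.
by rewrite (mulmxA C) -TE; do 2![apply: espanM => //].
Qed.

End OneRepresentation.

(* If [T = C D] has rank at least 2, then [D M C] is not scalar for a suitable
   [M], and [T M T - x T] has smaller rank for an eigenvalue [x] of [D M C]. *)
Lemma decrease_rank (E : fieldType) (phi : {rmorphism R -> 'M[E]_m}) T :
  phi e = 1 -> espan phi T -> (1 < \rank T)%N ->
  exists (E' : fieldType) (phi' : {rmorphism R -> 'M[E']_m}) T',
    [/\ phi' e = 1, espan phi' T' & (0 < \rank T' < \rank T)%N].
Proof.
move=> phie sT.
have [r [C [D [rE fullC freeD TE]]]] : exists r (C : 'M[E]_(m, r)) (D : 'M_(r, m)),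
    [/\ r = \rank T, row_full C, row_free D & T = C *m D].
  exists (\rank T), (col_base T), (row_base T).
  by rewrite col_base_full row_base_free mulmx_base.
rewrite -rE; case: r => [|[|r]] // in C D rE fullC freeD TE * => _.
pose i1 : 'I_r.+2 := lift ord0 ord0.
have [B BC] := row_fullP fullC.
have D0 : row 0 D != 0.
  apply: contraTneq freeD => D0; rewrite -kermx_eq0; apply/rowV0Pn.
  exists (delta_mx 0 0); first by apply/sub_kermxP; rewrite -rowE.
  by apply/eqP => /matrixP/(_ 0 0); rewrite !mxE => /eqP; rewrite oner_eq0.
(* This [M] makes row 0 of [X = D M C] the unit vector at [i1], so [X - x] keeps an off-diagonal
   entry 1 for every scalar [x] and cannot vanish. *)
have [M [sM DM]] :=
  minimal_rep_row_transitive phie (delta_mx 0 i1 *m B) D0.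
pose X := D *m M *m C.
have X01 : X 0 i1 = 1.
  have -> : X 0 i1 = (row 0 D *m M *m C) 0 i1 by rewrite -!row_mul [RHS]mxE.
  by rewrite DM -mulmxA BC mulmx1 mxE !eqxx.
have [|E' [iota [x rx]]] := @root_extension _ (char_poly X).
  by rewrite size_char_poly.
have [phi' phi'E] := extend_scalars iota phi.
pose Y := map_mx iota X - x%:M.
pose C' := map_mx iota C; pose D' := map_mx iota D.
have Y01 : Y 0 i1 = 1 by rewrite mxE [map_mx _ _ _ _]mxE X01 rmorph1 !mxE subr0.
exists E', phi', (C' *m Y *m D'); split.
- by rewrite phi'E /= phie map_mx1.
- have -> : C' *m Y *m D' = map_mx iota T *m map_mx iota M *m map_mx iota T +
      (- x) *: map_mx iota T.
    rewrite TE !map_mxM mulmxBr mulmxBl !map_mxM scaleNr !mulmxA.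
    by rewrite mul_mx_scalar -scalemxAl.
  have sp := map_espan phi'E.
  apply: espanD; last exact/espanZ/sp.
  by apply: espanM; [apply: espanM|]; apply: sp.
- apply/andP; split; last first.
    apply: leq_ltn_trans (mxrankM_maxl _ _) _.
    apply: leq_ltn_trans (mxrankM_maxr _ _) _.
    rewrite ltn_neqAle rank_leq_row andbT -/(row_free Y) -kermx_eq0.
    by rewrite -/(eigenspace _ x) -/(eigenvalue _ x) eigenvalue_root_char -map_char_poly.
  rewrite lt0n mxrank_eq0; apply: contraTneq (oner_neq0 E') => Z.
  have [B' B'D] : exists B', D' *m B' = 1%:M.
    by apply/row_freeP; rewrite /row_free mxrank_map.
  suff Y0 : Y = 0 by rewrite -Y01 Y0 mxE eqxx.
  rewrite -[Y]mulmx1 -B'D -[Y]mul1mx -(map_mx1 iota) -BC map_mxM -/C'.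
  by rewrite -!mulmxA (mulmxA Y) (mulmxA C') (mulmxA C') Z mul0mx mulmx0.
Qed.

(** The rank is lowered from the identity matrix down to 1. The field changes at each stage, and
    [min_m] still applies because it quantifies over all fields. *)
Lemma minimal_rep_espan_full :
  (exists (E : fieldType) (phi : {rmorphism R -> 'M[E]_m}), phi e = 1) ->
  exists (E : fieldType) (phi : {rmorphism R -> 'M[E]_m}),
    phi e = 1 /\ forall M, espan phi M.
Proof.
move=> [E0 [phi0 phi0e]].
suff H n : forall (E : fieldType) (phi : {rmorphism R -> 'M[E]_m}) T,
    phi e = 1 -> espan phi T -> (0 < \rank T <= n)%N ->
    exists (E : fieldType) (phi : {rmorphism R -> 'M[E]_m}),
      phi e = 1 /\ forall M, espan phi M.
  by apply: (H m E0 phi0 1%:M) => //; [apply: espan1|rewrite mxrank1 m_gt0 /=].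
elim: n => [|n IH] E phi T phie sT /andP[r0 rn]; first by rewrite ltnNge rn in r0.
have [r1|r1] := leqP (\rank T) 1.
  exists E, phi; split=> //; apply: rank1_espan_full sT _ => //.
  by apply/eqP; rewrite eqn_leq r1.
have [E' [phi' [T' [phi'e sT' /andP[r0' r1']]]]] := decrease_rank phie sT r1.
by apply: (IH _ _ T' phi'e sT'); rewrite r0' -ltnS (leq_trans r1').
Qed.

End MinimalRepresentation.

Lemma absolutely_irreducible_rep (R : pzRingType) (e : R) :
  (exists (E : fieldType) m (phi : {rmorphism R -> 'M[E]_m}),
     (0 < m)%N /\ phi e = 1) ->
  exists (E : fieldType) m (phi : {rmorphism R -> 'M[E]_m}),
    [/\ (0 < m)%N, phi e = 1 & forall M, espan phi M].
Proof.
move=> [E0 [m0 [phi0 [m0_gt0 phi0e]]]].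
pose P m := `[< (0 < m)%N /\ exists (E : fieldType)
  (phi : {rmorphism R -> 'M[E]_m}), phi e = 1 >].
have exP : exists m, P m.
  by exists m0; apply/asboolP; split=> //; exists E0, phi0.
have [m /asboolP [m_gt0 exm] min] := ex_minnP exP.
have [|E [phi [phie full]]] := @minimal_rep_espan_full R e m m_gt0 _ exm.
  by move=> E k phi k_gt0 phie; apply: min; apply/asboolP; split=> //; exists E, phi.
by exists E, m, phi.
Qed.

(** * The density theorem of Artin and Whaples *)

Section CentralSimpleCorner.
Variables (R : pzRingType) (e : R).
Hypothesis ce : central_idempotent e.

Local Notation K := (zeta (corner [set: R]%classic e)).

(** As [z = z * e], multiplying by [y] is the same as multiplying by [y * e]; centrality in the
    corner is thus centrality in [R]. *)
Lemma zeta_cornerP z : K z <-> z * e = z /\ forall y, z * y = y * z.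
Proof.
have [ee ec] := ce; split=> [[[x _ <-] zc]|[ze zc]].
  have xee : x * e * e = x * e by rewrite -mulrA ee.
  split=> // y; have E1 : x * e * (y * e) = x * e * y by rewrite -(ec y) mulrA xee.
  have E2 : y * e * (x * e) = y * (x * e) by rewrite -mulrA (ec (x * e)) xee.
  by rewrite -E1 -E2; apply: zc; exists y.
split; first by exists z.
by move=> y _; apply: zc.
Qed.

(* The multiplication algebra of R, as functions. *)
Inductive multop : (R -> R) -> Prop :=
| multop_id : multop id
| multop_l x T : multop T -> multop (fun r => x * T r)
| multop_r x T : multop T -> multop (fun r => T r * x)
| multop_add T T' : multop T -> multop T' -> multop (fun r => T r + T' r).

Lemma multop_comp T T' : multop T -> multop T' -> multop (T \o T').
Proof.
move=> mT mT'; elim: mT => {T} //= [x T _ IH|x T _ IH|T1 T2 _ IH1 _ IH2].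
- exact: multop_l x _ IH.
- exact: multop_r x _ IH.
- exact: multop_add IH1 IH2.
Qed.

Lemma multop_sub T T' : multop T -> multop T' -> multop (fun r => T r - T' r).
Proof.
move=> mT mT'; have := multop_add mT (multop_l (-1) mT').
by congr multop; apply/funext => r; rewrite mulN1r.
Qed.

Lemma multopD T : multop T -> {morph T : x y / x + y}.
Proof.
elim=> {T} // [x T _ IH|x T _ IH|T1 T2 _ IH1 _ IH2] r s.
- by rewrite IH mulrDr.
- by rewrite IH mulrDl.
- by rewrite IH1 IH2 addrACA.
Qed.

Lemma multop_central T c x : multop T -> (forall y, c * y = y * c) ->
  T (c * x) = c * T x.
Proof.
move=> mT cc; elim: mT => {T} // [y T _ ->|y T _ ->|T1 T2 _ -> _ ->].
- by rewrite !mulrA cc.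
- by rewrite mulrA.
- by rewrite mulrDr.
Qed.

Lemma multop_sum T : multop T -> forall n (f : 'I_n -> R),
  T (\sum_(k < n) f k) = \sum_(k < n) T (f k).
Proof.
move=> mT n f; apply: (big_morph T); first exact: multopD.
by have := multop_central 0 mT (c := 0); rewrite !mul0r; apply=> y; rewrite mul0r mulr0.
Qed.

Lemma multop0 T : multop T -> T 0 = 0.
Proof. by move=> /multop_sum/(_ 0%N (fun=> 0)); rewrite !big_ord0. Qed.

Lemma multopB T : multop T -> {morph T : x y / x - y}.
Proof.
by move=> mT x y; rewrite -{2}(subrK y x) (multopD mT (x - y)) addrK.
Qed.

Lemma multop_corner T x : multop T -> x * e = x -> T x * e = T x.
Proof.
have [_ ec] := ce.
by move=> mT xe; rewrite -{2}xe -[x * e]ec multop_central // ec.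
Qed.

(** [phi] turns [T] into two-sided multiplications by matrices, and these are [E]-linear. Through
    this lemma density in [R] yields independence over [E]. *)
Lemma multop_relation (E : fieldType) m (phi : {rmorphism R -> 'M[E]_m}) T n
    (d : 'I_n -> E) (a : 'I_n -> R) : multop T ->
  \sum_(k < n) d k *: phi (a k) = 0 -> \sum_(k < n) d k *: phi (T (a k)) = 0.
Proof.
move=> mT da; elim: mT => {T} // [x T _ IH|x T _ IH|T1 T2 _ IH1 _ IH2].
- under eq_bigr do rewrite rmorphM [_ * _]/(_ *m _) scalemxAr.
  by rewrite -mulmx_sumr IH mulmx0.
- under eq_bigr do rewrite rmorphM [_ * _]/(_ *m _) scalemxAl.
  by rewrite -mulmx_suml IH mul0mx.
- under eq_bigr do rewrite rmorphD scalerDr.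
  by rewrite big_split /= IH1 IH2 addr0.
Qed.

(** The values [T x] form the two-sided ideal generated by [x], so this is simplicity of [R e]. *)
Definition simple_corner : Prop :=
  forall x, x * e = x -> x <> 0 -> exists T, multop T /\ T x = e.

Definition center_span (s : seq R) (x : R) : Prop :=
  exists c : nat -> R, (forall k, K (c k)) /\ x = \sum_(k < size s) c k * s`_k.

(* Artin-Whaples: the Jacobson density theorem for the multiplication algebra,
   whose commutant on [R e] is the centre. *)
Lemma artin_whaples (s : seq R) : simple_corner -> forall a, a * e = a ->
  center_span s a \/
  exists T, [/\ multop T, forall k, (k < size s)%N -> T s`_k = 0 & T a = e].
Proof.
have [ee ec] := ce; move=> simple; have K0 : K 0 by apply/zeta_cornerP; split=> [|y]; rewrite ?mul0r ?mulr0.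
elim: s => [|t s IH] a ae; have [a0|/eqP a0] := eqVneq a 0.
- by left; exists (fun=> 0); split=> //; rewrite a0 big_ord0.
- by have [T [mT Ta]] := simple a ae a0; right; exists T.
- left; exists (fun=> 0); split=> //.
  by rewrite a0 big1 // => k _; rewrite mul0r.
have span_cons z b : K z -> center_span s b -> center_span (t :: s) (b + z * t).
  move=> Kz [c [Kc ->]]; exists (fun k => if k is k'.+1 then c k' else z); split.
    by case.
  by rewrite /= big_ord_recl /= addrC.
have T_cons T b : multop T -> (forall k, (k < size s)%N -> T s`_k = 0) ->
    T t = 0 -> b * e = b -> T b <> 0 ->
    exists T, [/\ multop T, forall k, (k < size (t :: s))%N -> T (t :: s)`_k = 0
                & T b = e].
  move=> mT Ts Tt be Tb0.
  have [T' [mT' T'e]] := simple (T b) (multop_corner mT be) Tb0.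
  exists (T' \o T); split=> //; first exact: multop_comp.
  by case=> [|k] /= lk; rewrite ?Tt ?Ts // multop0.
(* If [t * e] is already in the span of [s], an operator that kills [s] kills [t * e], and
   multiplying its values by [e] makes it kill [t]. *)
have [[c [Kc te]]|[T0 [mT0 T0s T0t]]] := IH (t * e) ltac:(by rewrite -mulrA ee).
  have [sp|[T [mT Ts Ta]]] := IH a ae.
    by left; rewrite -[a]addr0 -(mul0r t); apply: span_cons.
  right; have Tte : T (t * e) = 0.
    rewrite te multop_sum // big1 // => k _.
    by rewrite multop_central ?Ts ?mulr0 //; have /zeta_cornerP [] := Kc k.
  pose T' r := T r * e.
  apply: (T_cons T'); rewrite /T' ?Ta //.
  - exact: multop_r.
  - by move=> k /Ts ->; rewrite mul0r.
  - by rewrite -ec -multop_central // ec.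
  - by rewrite ee => e0; apply: a0; rewrite -ae e0 mulr0.
pose T1 r := T0 r * e.
have mT1 : multop T1 by apply: multop_r.
have T1s k : (k < size s)%N -> T1 s`_k = 0 by move=> /T0s; rewrite /T1 => ->; rewrite mul0r.
have T1t : T1 t = e by rewrite /T1 -ec -multop_central // ec.
(* If [T1 a] is not central, the commutator of [T1] with some [r] kills [s] and [t], because
   [T1 t = e] is central, but not [a]. If it is central, [a] is replaced by [a - T1 a * t]. *)
have [Kz|nKz] := pselect (K (T1 a)); last first.
  right; have [r zr] : exists r, T1 a * r <> r * T1 a.
    apply: contrapT => H; apply: nKz; apply/zeta_cornerP.
    split=> [|r]; first by rewrite /T1 -mulrA ee.
    by apply: contrapT => zr; apply: H; exists r.
  apply: (T_cons (fun x => T1 x * r - r * T1 x)) => //.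
  - by apply: multop_sub; [apply: multop_r|apply: multop_l].
  - by move=> k /T1s ->; rewrite mul0r mulr0 subrr.
  - by rewrite T1t ec subrr.
  - by move/eqP; rewrite subr_eq0 => /eqP.
have /zeta_cornerP [ze zc] := Kz.
have be : (a - T1 a * t) * e = a - T1 a * t.
  by rewrite mulrBl ae -[T1 a * t * e]mulrA -ec mulrA ze.
have [sp|[T [mT Ts Tb]]] := IH _ be.
  by left; rewrite -(subrK (T1 a * t) a); apply: span_cons.
(* The correction term makes the operator vanish at [t]; its value at [a] is
   [T (a - T1 a * t) = e]. *)
right; apply: (T_cons (fun r => T r * e - T t * T1 r)) => //.
- by apply: multop_sub; [apply: multop_r|apply: multop_l].
- by move=> k lk; rewrite Ts // T1s // mul0r mulr0 subrr.
- by rewrite T1t subrr.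
- rewrite (multop_corner mT ae) -zc -multop_central // -multopB // Tb => e0.
  by apply: a0; rewrite -ae e0 mulr0.
Qed.

End CentralSimpleCorner.

(** * Existence of splittings *)

Lemma commuting_is_scalar (E : fieldType) m (X : 'M[E]_m) :
  (forall M, X *m M = M *m X) -> is_scalar_mx X.
Proof.
case: m X => [|m] X comX.
  by rewrite /is_scalar_mx; case: insubP => // -[].
apply/is_scalar_mxP; exists (X 0 0); apply/matrixP => i j.
have /matrixP/(_ i 0) := comX (delta_mx j 0).
rewrite !mxE (bigD1 j) //= big1 => [|k kj]; last by rewrite mxE (negbTE kj) mulr0.
rewrite mxE !eqxx mulr1 addr0 (bigD1 0) //= big1 => [|k k0]; last first.
  by rewrite mxE (negbTE k0) andbF mul0r.
by rewrite mxE eqxx andbT addr0 mulr_natl => ->.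
Qed.

Section SplittingExists.
Variables (R : pzRingType) (e : R).
Hypothesis ce : central_idempotent e.
Local Notation K := (zeta (corner [set: R]%classic e)).

(** [K] is only a set here, without a field structure, so a spanning list of least length replaces a
    basis: if some [s_k] were in the span of the others, it could be dropped. *)
Lemma minimal_center_spanning :
  (exists s, forall x, x * e = x -> center_span e s x) ->
  exists s : seq R, [/\ forall k, s`_k * e = s`_k,
    forall x, x * e = x -> center_span e s x &
    forall k, (k < size s)%N ->
      ~ center_span e (mkseq (fun i => s`_(bump k i)) (size s).-1) s`_k].
Proof.
have [ee ec] := ce; move=> [s0 sp0].
pose P n := `[< exists s : seq R, [/\ size s = n, forall k, s`_k * e = s`_k &
  forall x, x * e = x -> center_span e s x] >].
have exP : exists n, P n.
  exists (size s0); apply/asboolP; exists [seq x * e | x <- s0]; split.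
  - by rewrite size_map.
  - move=> k; have [lk|gk] := ltnP k (size s0).
      by rewrite (nth_map 0) // -mulrA ee.
    by rewrite nth_default ?size_map // mul0r.
  - move=> x /sp0 [c [Kc ->]]; exists c; split=> //; rewrite size_map.
    apply: eq_bigr => k _; rewrite (nth_map 0) // -ec mulrA.
    by have /(zeta_cornerP ce) [-> _] := Kc k.
have [n /asboolP [s [sn se sps]] min] := ex_minnP exP.
exists s; split=> // k lk [c' [Kc' sk]].
suff /min : P n.-1 by rewrite -sn -ltnS prednK ?ltnn // (leq_ltn_trans _ lk).
apply/asboolP; exists (mkseq (fun i => s`_(bump k i)) (size s).-1); split.
- by rewrite size_mkseq sn.
- move=> i; have [li|gi] := ltnP i (size s).-1; first by rewrite nth_mkseq.
  by rewrite nth_default ?size_mkseq // mul0r.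
- move=> x /sps [c [Kc ->]].
  exists (fun i => c k * c' i + c (bump k i)); split.
    move=> i; apply/(zeta_cornerP ce).
    have /(zeta_cornerP ce) [c1 c1c] := Kc k.
    have /(zeta_cornerP ce) [c2 c2c] := Kc' i.
    have /(zeta_cornerP ce) [c3 c3c] := Kc (bump k i).
    split=> [|y]; first by rewrite mulrDl -mulrA c2 c3.
    by rewrite mulrDl mulrDr c3c -mulrA c2c mulrA c1c mulrA.
  rewrite (bigD1_ord (Ordinal lk)) //= {1}sk size_mkseq mulr_sumr -big_split /=.
  by apply: eq_bigr => i _; rewrite nth_mkseq // mulrDl mulrA.
Qed.

(** The ideal generated by a nonzero [x] contains [e], so [phi x = 0] would give [phi e = 0]. *)
Lemma simple_corner_rep_inj (E : fieldType) m (phi : {rmorphism R -> 'M[E]_m}) x :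
  simple_corner e -> (0 < m)%N -> phi e = 1 -> x * e = x -> phi x = 0 -> x = 0.
Proof.
move=> simple m_gt0 phie xe phix; apply: contrapT => x0.
have [T [mT Tx]] := simple x xe x0.
have /(_ _)/= := multop_relation (phi := phi) (n := 1) (d := fun=> 1) (a := fun=> x) mT.
rewrite !big_ord_recl !big_ord0 !addr0 phix Tx phie !scale1r.
move=> /(_ erefl)/matrixP/(_ (Ordinal m_gt0) (Ordinal m_gt0)).
by rewrite !mxE eqxx => /eqP; rewrite oner_eq0.
Qed.

Lemma splitting_exists :
  simple_corner e ->
  (exists s, forall x, x * e = x -> center_span e s x) ->
  (exists (E : fieldType) m (phi : {rmorphism R -> 'M[E]_m}),
     (0 < m)%N /\ phi e = 1) ->
  exists (E : fieldType) m (phi : {rmorphism R -> 'M[E]_m}),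
    (0 < m)%N /\ splitting e phi.
Proof.
have [ee ec] := ce; move=> simple.
move=> /minimal_center_spanning [s [se sps mins]] /absolutely_irreducible_rep.
move=> [E [m [phi [m_gt0 phie full]]]]; exists E, m, phi; split=> //.
(* A central element commutes with the image of [phi], hence with its span, which is the whole
   matrix algebra. *)
have Kscalar z : K z -> is_scalar_mx (phi z).
  move=> /(zeta_cornerP ce) [_ zc]; apply: commuting_is_scalar => M.
  elim: (full M) => [r|c N _ IH|N P _ IH1 _ IH2].
  - by have := congr1 phi (zc r); rewrite !rmorphM.
  - by rewrite -scalemxAr IH scalemxAl.
  - by rewrite mulmxDr IH1 IH2 mulmxDl.
(* By irredundance and density some [T] sends [s_k] to [e] and the other members to 0; applied to an
   [E]-relation it isolates [d k]. *)
have free_phi (d : 'I_(size s) -> E) :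
    \sum_(k < size s) d k *: phi s`_k = 0 -> forall k, d k = 0.
  move=> ds k; have [sp|[T [mT Ts Tk]]] :=
    artin_whaples ce (mkseq (fun i => s`_(bump k i)) (size s).-1) simple (se k).
    by have := mins k (ltn_ord k) sp.
  have := multop_relation mT ds; rewrite (bigD1_ord k) //= Tk phie big1.
    by rewrite addr0 => /matrixP/(_ (Ordinal m_gt0) (Ordinal m_gt0));
      rewrite !mxE eqxx mulr1.
  move=> i _; have := Ts i; rewrite size_mkseq nth_mkseq // => ->//.
  by rewrite rmorph0 scaler0.
split=> //; exists (size s), (fun k => s`_k); split.
- by move=> k; exists s`_k.
- move=> _ [x _ <-]; have [|c [Kc xE]] := sps (x * e); first by rewrite -mulrA ee.
  exists (fun k => c k); split=> [|c' [Kc' xE']]; first by split.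
  apply/funext => k; apply/eqP; rewrite -subr_eq0; apply/eqP.
  have Kd (j : 'I_(size s)) : K (c j - c' j).
    apply/(zeta_cornerP ce); have /(zeta_cornerP ce) [c1 c1c] := Kc j.
    have /(zeta_cornerP ce) [c2 c2c] := Kc' j.
    by split=> [|y]; [rewrite mulrBl c1 c2|rewrite mulrBl mulrBr c1c c2c].
  pose d (j : 'I_(size s)) := phi (c j - c' j) (Ordinal m_gt0) (Ordinal m_gt0).
  have dE (j : 'I_(size s)) : phi (c j - c' j) = (d j)%:M.
    by rewrite /d; have /is_scalar_mxP [a ->] := Kscalar _ (Kd j); rewrite mxE eqxx.
  have d0 : forall k, d k = 0.
    apply: free_phi.
    have cc' : \sum_(j < size s) (c j - c' j) * s`_j = 0.
      by under eq_bigr do rewrite mulrBl; rewrite sumrB -xE -xE' subrr.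
    rewrite -[RHS](rmorph0 phi) -[in RHS]cc' rmorph_sum.
    by apply: eq_bigr => j _ /=; rewrite rmorphM /= dE [RHS]mul_scalar_mx.
  apply: (simple_corner_rep_inj simple m_gt0 phie).
    by have /(zeta_cornerP ce) [] := Kd k.
  by rewrite dE d0 raddf0.
- pose X := [tuple phi s`_k | k < size s].
  have -> : [seq phi s`_k | k : 'I_(size s)] = X by [].
  have Xk (k : 'I_(size s)) : X`_k = phi s`_k by rewrite -tnth_nth tnth_mktuple.
  rewrite /basis_of; apply/andP; split; last first.
    by apply/freeP => d; under eq_bigr do rewrite Xk; apply: free_phi.
  rewrite eqEsubv subvf /=; apply/subvP => M _.
  elim: (full M) => [r|c N _|N P _ IH1 _]; [|exact: memvZ|exact: memvD].
  have [c [Kc rE]] := sps (r * e) ltac:(by rewrite -mulrA ee).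
  have -> : phi r = phi (r * e) by rewrite rmorphM phie mulr1.
  rewrite rE rmorph_sum; apply: memv_suml => k _ /=.
  have /is_scalar_mxP [a ca] := Kscalar _ (Kc k).
  rewrite rmorphM ca [_ * _]mul_scalar_mx; apply: memvZ.
  by apply: memv_span; rewrite -Xk mem_nth ?size_tuple.
Qed.

End SplittingExists.

(** * Central primitive idempotents of semisimple algebras *)

Section CentralIdempotents.
Variable R : pzRingType.

Lemma central_idempotentM (u v : R) :
  central_idempotent u -> central_idempotent v -> central_idempotent (u * v).
Proof.
move=> [uu uc] [vv vc]; split=> [|x]; last by rewrite -mulrA vc mulrA uc mulrA.
by rewrite -mulrA (mulrA v) vc -!mulrA vv mulrA uu.
Qed.

Lemma central_idempotentC (u : R) : central_idempotent u -> central_idempotent (1 - u).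
Proof.
move=> [uu uc]; split=> [|x]; last by rewrite mulrBl mulrBr mul1r mulr1 uc.
by rewrite mulrBl mul1r mulrBr mulr1 uu subrr subr0.
Qed.

(** Primitivity is applied to the decomposition [e = e * u + e * (1 - u)]. *)
Lemma cpi_absorb (e u : R) : central_primitive_idempotent e ->
  central_idempotent u -> e * u <> 0 -> e * u = e.
Proof.
move=> [ce _ prim] cu eu0.
have [||||eu|eu] := prim (e * u) (e * (1 - u)).
- exact: central_idempotentM.
- by apply/central_idempotentM => //; apply: central_idempotentC.
- have [[_ ec] [uu _]] := (ce, cu).
  by rewrite -mulrA (mulrA u) -ec -mulrA mulrBr mulr1 uu subrr !mulr0.
- by rewrite -mulrDr addrC subrK mulr1.
- by [].
- by apply/eqP; rewrite -subr_eq0 -{2}[e]mulr1 -mulrBr -opprB mulrN eu oppr0.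
Qed.

Lemma cpi_eq (e f : R) : central_primitive_idempotent e ->
  central_primitive_idempotent f -> e * f <> 0 -> e = f.
Proof.
move=> pe pf ef0; have [[ce _ _] [cf _ _]] := (pe, pf).
rewrite -[LHS](cpi_absorb pe cf ef0) -[RHS](cpi_absorb pf ce) ?(proj2 ce) //.
by rewrite -(proj2 ce).
Qed.

End CentralIdempotents.

Section FiniteDimensional.
Variables (F : fieldType) (A : falgType F).

Lemma prodv_ind (P : A -> Prop) (U V : {vspace A}) :
  P 0 -> (forall x y, P x -> P y -> P (x + y)) ->
  (forall c x, P x -> P (c *: x)) ->
  (forall u v, u \in U -> v \in V -> P (u * v)) ->
  forall w, w \in (U * V)%VS -> P w.
Proof.
move=> P0 PD PZ PM w; rewrite [@prodv _ _]unlock => /(coord_span (X := in_tuple _)) ->.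
elim/big_ind: _ => // i _; apply: PZ.
have /allpairsP [[u v] /= [/vbasis_mem Uu /vbasis_mem Vv ->]] :=
  mem_nth 0 (ltn_ord i).
exact: PM.
Qed.

(** A central idempotent that is not primitive splits in two, and the dimension of the ideal it
    generates bounds the recursion. Completeness of the list follows from its sum being 1. *)
Lemma cpi_list : exists es : seq A,
  [/\ uniq es, \sum_(e <- es) e = 1,
      forall e, central_primitive_idempotent e <-> e \in es &
      forall e f, e \in es -> f \in es -> e != f -> e * f = 0].
Proof.
suff H n (e : A) : central_idempotent e -> (\dim ({:A} * <[e]>) < n)%N ->
  exists es : seq A, [/\ uniq es, \sum_(f <- es) f = e,
    forall f, f \in es -> central_primitive_idempotent f /\ f * e = f &
    forall f g, f \in es -> g \in es -> f != g -> f * g = 0].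
  have c1 : central_idempotent (1 : A).
    by split=> [|x]; rewrite ?mulr1 ?mul1r.
  have [es [ues sum1 es_cpi es_orth]] := H _ 1 c1 (ltnSn _).
  exists es; split=> // e; split; last by case/es_cpi.
  move=> pe; apply: contrapT => /negP Ne; have [_ e0 _] := pe; apply: e0.
  rewrite -[e]mulr1 -sum1 mulr_sumr big_seq big1 // => f fes.
  apply: contrapT => ef0; have [pf _] := es_cpi f fes.
  by move: Ne; rewrite (cpi_eq pe pf ef0) fes.
elim: n e => // n IH e ce; rewrite ltnS => dime.
have [->|/eqP e0] := eqVneq e 0.
  by exists [::]; split=> //; rewrite big_nil.
have [pe|npe] := pselect (central_primitive_idempotent e).
  exists [:: e]; split=> //; first by rewrite big_seq1.
    by move=> f; rewrite inE => /eqP ->; split=> //; case: ce.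
  by move=> f g; rewrite !inE => /eqP -> /eqP ->; rewrite eqxx.
have [u [v [cu cv uv euv [u0 v0]]]] : exists u v : A, [/\ central_idempotent u,
    central_idempotent v, u * v = 0, e = u + v & u <> 0 /\ v <> 0].
  apply: contrapT => H; apply: npe; split=> // u v cu cv uv euv.
  have [->|/eqP u0] := eqVneq u 0; first by left.
  have [->|/eqP v0] := eqVneq v 0; first by right.
  by case: H; exists u, v.
have vu : v * u = 0 by rewrite (proj2 cv).
have ue : u * e = u by rewrite euv mulrDr (proj1 cu) uv addr0.
have ve : v * e = v by rewrite euv mulrDr (proj1 cv) vu add0r.
(* The inclusion of [A a] in [A e] is strict: [b] lies in [A e], and if it lay in [A a] then
   [b = b * b = 0]. *)
have small (a b : A) : a * e = a -> b * e = b -> b * a = 0 ->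
    central_idempotent b -> b <> 0 -> (\dim ({:A} * <[a]>) < n)%N.
  move=> ae be ba cb b0; apply: leq_trans dime.
  have sub : ({:A} * <[a]> <= {:A} * <[e]>)%VS.
    apply/prodvP => x _ _ /vlineP [c ->].
    by rewrite -ae -scalerAr scalerAl mulrA memv_mul ?memvf ?memv_line.
  have [le eqd] := dimv_leqif_eq sub.
  rewrite ltn_neqAle le andbT eqd; apply/eqP => aE; apply: b0.
  have : b \in ({:A} * <[a]>)%VS by rewrite aE -be memv_mul ?memvf ?memv_line.
  move=> bA; rewrite -(proj1 cb).
  move: b bA be ba cb => b bA _ ba cb.
  suff H : forall w, w \in ({:A} * <[a]>)%VS -> b * w = 0 by apply: H.
  apply: prodv_ind => [|x y xb yb|c x xb|x _ _ /vlineP [c ->]].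
  - by rewrite mulr0.
  - by rewrite mulrDr xb yb addr0.
  - by rewrite -scalerAr xb scaler0.
  - by rewrite -!scalerAr mulrA (proj2 cb) -mulrA ba mulr0 scaler0.
have [es [ues sumu es_cpi es_orth]] := IH u cu (small u v ue ve vu cv v0).
have [fs [ufs sumv fs_cpi fs_orth]] := IH v cv (small v u ve ue uv cu u0).
have es_fs a b : a \in es -> b \in fs -> a * b = 0.
  move=> /es_cpi [_ au] /fs_cpi [_ bv].
  by rewrite -au -bv -mulrA -(proj2 cv) (mulrA u) uv mul0r mulr0.
have fs_es a b : a \in es -> b \in fs -> b * a = 0.
  by move=> aes bfs; have [[_ bc] _ _] := (fs_cpi b bfs).1; rewrite bc es_fs.
exists (es ++ fs); split.
- rewrite cat_uniq ues ufs andbT; apply/hasPn => a afs; apply/negP => aes.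
  by have [[aa _] a0 _] := (es_cpi a aes).1; apply: a0; rewrite -aa es_fs.
- by rewrite big_cat /= sumu sumv.
- move=> a; rewrite mem_cat => /orP [/es_cpi|/fs_cpi] [pa aE]; split=> //.
    by rewrite -aE -mulrA ue.
  by rewrite -aE -mulrA ve.
- move=> a b; rewrite !mem_cat => /orP [aes|afs] /orP [bes|bfs] ab.
  + exact: es_orth.
  + exact: es_fs.
  + exact: fs_es.
  + exact: fs_orth.
Qed.

Hypothesis ssA : semisimple_algebra A.

(** Write [1 = u + u'] along a complementary left ideal [W']; for [w] in [W] the product [w * u']
    lies in both [W] and [W']. *)
Lemma two_sided_right_unit (W : {vspace A}) :
  ({:A} * W <= W)%VS -> (W * {:A} <= W)%VS ->
  exists u, u \in W /\ forall w, w \in W -> w * u = w.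
Proof.
move=> Wl Wr; have [W' [W'l WW' cap]] := ssA Wl.
have : 1 \in (W + W')%VS by rewrite WW' memvf.
case/memv_addP => u Wu [u' W'u' E]; exists u; split=> // w Ww.
have wE : w * u' = w - w * u by rewrite -{2}[w]mulr1 E mulrDr addrC addKr.
have : w * u' \in (W :&: W')%VS.
  rewrite memv_cap (subvP W'l) ?memv_mul ?memvf // andbT.
  by rewrite (subvP Wr) // memv_mul ?memvf.
by rewrite cap memv0 wE subr_eq0 => /eqP <-.
Qed.

Lemma two_sided_unit (W : {vspace A}) :
  ({:A} * W <= W)%VS -> (W * {:A} <= W)%VS ->
  exists u, [/\ u \in W, forall w, w \in W -> w * u = w & central_idempotent u].
Proof.
move=> Wl Wr; have [u [Wu uW]] := two_sided_right_unit Wl Wr.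
(* The ideal [J = A y A] has a right unit [v], so [y = y * v] lies in [W J], which is contained in
   [W y A = 0]. Applied to [w - u * w], this makes the right unit [u] two-sided and then central. *)
have faithful y : y \in W -> (forall w, w \in W -> w * y = 0) -> y = 0.
  move=> Wy Wy0; pose J := ({:A} * <[y]> * {:A})%VS.
  have [||v [Jv vJ]] := @two_sided_right_unit J.
  - by rewrite /J !prodvA prodv_id.
  - by rewrite /J -!prodvA prodv_id.
  have Jy : y \in J by rewrite -[y]mul1r -[1 * y]mulr1 !memv_mul ?memvf ?memv_line.
  rewrite -(vJ y Jy); apply/eqP; rewrite -memv0.
  apply: (subvP _ _ (memv_mul Wy Jv)); rewrite /J !prodvA.
  apply: subv_trans (prodvSl _ (prodvSl _ Wr)) _.
  suff WY : (W * <[y]> <= 0)%VS.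
    by apply: subv_trans (prodvSl _ WY) _; rewrite prod0v sub0v.
  by apply/prodvP => w _ Ww /vlineP [c ->]; rewrite -scalerAr Wy0 // scaler0 mem0v.
have uWl w : w \in W -> u * w = w.
  move=> Ww; apply/eqP; rewrite eq_sym -subr_eq0; apply/eqP/faithful => [|x Wx].
    by rewrite memvB // (subvP Wl) ?memv_mul ?memvf.
  by rewrite mulrBr mulrA uW // subrr.
exists u; split=> //; split=> [|x]; first exact: uW.
have xuW : x * u \in W by rewrite (subvP Wl) ?memv_mul ?memvf.
have uxW : u * x \in W by rewrite (subvP Wr) ?memv_mul ?memvf.
by rewrite -(uW _ uxW) -mulrA uWl.
Qed.

(** The ideal [A x A] has a central unit [u]. By primitivity [e * u = e], since otherwise
    [x = x * e * u] would vanish; so [e] is a combination of products [a * x * b]. *)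
Lemma cpi_simple (e : A) : central_primitive_idempotent e -> simple_corner e.
Proof.
move=> pe x xe x0; have [ce _ _] := pe.
pose W := ({:A} * <[x]> * {:A})%VS.
have [||u [Wu uW cu]] := @two_sided_unit W.
- by rewrite /W !prodvA prodv_id.
- by rewrite /W -!prodvA prodv_id.
have Wx : x \in W by rewrite -[x]mul1r -[1 * x]mulr1 !memv_mul ?memvf ?memv_line.
have eu : e * u = e.
  apply: cpi_absorb => // eu0; apply: x0.
  by rewrite -(uW x Wx) -xe -mulrA eu0 mulr0.
have : e \in W.
  rewrite -eu; have : (({:A} * W) <= W)%VS by rewrite /W !prodvA prodv_id.
  by move/subvP; apply; rewrite memv_mul ?memvf.
move: e {pe xe ce eu}.
have mZ c T : multop T -> multop (fun r => c *: T r :> A).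
  by move=> mT; have := multop_l (c%:A) mT; congr multop; apply/funext => r; rewrite mulr_algl.
apply: prodv_ind => [|a b [T [mT <-]] [S [mS <-]]|c a [T [mT <-]]|a b].
- exists (fun=> 0); split=> //; have := multop_l 0 (multop_id A).
  by congr multop; apply/funext => r; rewrite mul0r.
- by exists (fun r => T r + S r); split=> //; apply: multop_add.
- by exists (fun r => c *: T r); split=> //; apply: mZ.
- move=> + _; move: a; apply: prodv_ind => [|a a' [T [mT Ta]] [S [mS Sa]]|c a [T [mT Ta]]|a _ _ /vlineP [c ->]].
  + exists (fun=> 0); rewrite mul0r; split=> //; have := multop_l 0 (multop_id A).
    by congr multop; apply/funext => r; rewrite mul0r.
  + exists (fun r => T r + S r); rewrite mulrDl Ta Sa; split=> //; exact: multop_add.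
  + by exists (fun r => c *: T r); rewrite -scalerAl Ta; split=> //; apply: mZ.
  + exists (fun r => c *: (a * r * b)); split; last by rewrite -scalerAr -scalerAl.
    exact/mZ/multop_r/multop_l/multop_id.
Qed.

End FiniteDimensional.

(** * Matrices over a simple component *)

Lemma linear_map_mx (F : fieldType) (V : vectType F) (f : V -> V) :
  linear f -> exists M : 'M[F]_(dim V), forall v, v2r v *m M = v2r (f v).
Proof.
move=> fL; pose mL := GRing.isLinear.Build F V V *:%R f fL.
pose g : {linear V -> V} := HB.pack f mL.
by exists (lin1_mx (v2r \o g \o r2v)) => v; rewrite mul_rV_lin1 /= v2rK.
Qed.

Section MatrixCorner.
Variables (A : nzRingType) (b : nat) (e : A).
Hypothesis ce : central_idempotent e.

Lemma central_idempotent_scalar : central_idempotent (e%:M : 'M[A]_b).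
Proof.
have [ee ec] := ce; split=> [|X]; first by rewrite -[LHS]scalar_mxM ee.
rewrite [LHS]mul_scalar_mx; apply/matrixP => i j; rewrite [_ * _]/(_ *m _) !mxE ec.
rewrite (bigD1 j) //= big1 ?addr0 => [|k kj]; first by rewrite mxE eqxx.
by rewrite mxE (negbTE kj) mulr0.
Qed.

Lemma multop_scalar T : multop T ->
  exists T' : 'M[A]_b -> 'M[A]_b, multop T' /\ forall a, T' a%:M = (T a)%:M.
Proof.
elim=> {T} [|x T _ [T' [mT' T'E]]|x T _ [T' [mT' T'E]]|T1 T2 _ [T1' [m1 E1]] _ [T2' [m2 E2]]].
- by exists id; split=> //; apply: multop_id.
- exists (fun r => x%:M * T' r); split=> [|a]; first exact: multop_l.
  by rewrite T'E -[LHS]scalar_mxM.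
- exists (fun r => T' r * x%:M); split=> [|a]; first exact: multop_r.
  by rewrite T'E -[LHS]scalar_mxM.
- exists (fun r => T1' r + T2' r); split=> [|a]; first exact: multop_add.
  by rewrite E1 E2 raddfD.
Qed.

(** Written with matrix units, the operator is the sum over [k] of [E_ki X E_jk]. It brings a matrix
    to a scalar one, where the operators of [A] apply. *)
Lemma multop_entry i j : multop (fun X : 'M[A]_b => (X i j)%:M).
Proof.
have mul0 : multop (fun _ : 'M[A]_b => 0).
  by have := multop_l 0 (multop_id 'M[A]_b); congr multop; apply/funext => r; rewrite mul0r.
suff -> : (fun X : 'M[A]_b => (X i j)%:M) =
    fun X => \sum_(k < b) delta_mx k i * X * delta_mx j k.
  elim: (index_enum _) => [|k s IH].
    by move: mul0; congr multop; apply/funext => X; rewrite big_nil.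
  have := multop_add (multop_r (delta_mx j k) (multop_l (delta_mx k i) (multop_id _))) IH.
  by congr multop; apply/funext => X; rewrite big_cons.
apply/funext => X; apply/matrixP => p q; rewrite summxE mxE.
have dE k : (delta_mx k i * X * delta_mx j k) p q = X i j *+ ((p == k) && (q == k)).
  rewrite [_ * _]/(_ *m _ *m _) mxE (bigD1 j) //= big1 => [|l lj]; last first.
    by rewrite [delta_mx _ _ _ _]mxE (negbTE lj) mulr0.
  rewrite addr0 mxE (bigD1 i) //= big1 => [|l li]; last first.
    by rewrite mxE (negbTE li) andbF mul0r.
  rewrite !mxE !eqxx addr0 andbT /=.
  by case: (p == k); case: (q == k); rewrite ?mul1r ?mulr1 ?mul0r ?mulr0.
under eq_bigr do rewrite dE.
rewrite (bigD1 p) //= eqxx big1 ?addr0 => [|k kp]; first by rewrite eq_sym.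
by rewrite eq_sym (negbTE kp).
Qed.

Lemma matrix_simple_corner : simple_corner e -> simple_corner (e%:M : 'M[A]_b).
Proof.
move=> simple X Xe X0.
have [i [j Xij]] : exists i j, X i j <> 0.
  apply: contrapT => H; apply: X0; apply/matrixP => i j; rewrite mxE.
  by apply: contrapT => Xij; apply: H; exists i, j.
have Xije : X i j * e = X i j.
  rewrite -(proj2 ce) -[in RHS]Xe -(proj2 central_idempotent_scalar).
  by rewrite [_ * X]mul_scalar_mx mxE.
have [T [mT Te]] := simple _ Xije Xij; have [T' [mT' T'E]] := multop_scalar mT.
exists (T' \o (fun X : 'M[A]_b => (X i j)%:M)); rewrite /= T'E Te; split=> //.
exact/multop_comp/multop_entry.
Qed.

End MatrixCorner.

Lemma center_span_sum (R : pzRingType) (e : R) (I : finType) (c g : I -> R) :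
  (forall i, zeta (corner [set: R]%classic e) (c i)) ->
  zeta (corner [set: R]%classic e) 0 ->
  center_span e [seq g i | i <- enum I] (\sum_i c i * g i).
Proof.
move=> Kc K0; exists (nth 0 [seq c i | i <- enum I]); split=> [k|].
  have [lk|gk] := ltnP k (size [seq c i | i <- enum I]).
    by have /mapP [i _ ->] := mem_nth 0 lk.
  by rewrite nth_default.
rewrite -big_enum /=; elim: (enum I) => [|i s IH]; first by rewrite big_nil big_ord0.
by rewrite big_cons IH /= big_ord_recl.
Qed.

Section SplittingMatrixAlgebra.
Variables (F : fieldType) (A : falgType F) (b : nat) (e : A).
Hypothesis ce : central_idempotent e.

(** Coefficients in [F e], which is part of the centre, suffice: the list consists of the matrix
    units times an [F]-basis of [A]. *)
Lemma matrix_center_span : exists s : seq 'M[A]_b,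
  forall X, X * e%:M = X -> center_span (e%:M) s X.
Proof.
have [ee ec] := ce; pose B : seq A := vbasis {:A}.
pose g (t : 'I_b * 'I_b * 'I_(\dim {:A})) : 'M[A]_b :=
  delta_mx t.1.1 t.1.2 * (B`_t.2)%:M.
exists [seq g t | t <- enum {: 'I_b * 'I_b * 'I_(\dim {:A})}] => X Xe.
have Kscal (a : F) : zeta (corner [set: 'M[A]_b]%classic e%:M) ((a *: e)%:M).
  apply/zeta_cornerP; first exact: central_idempotent_scalar.
  split=> [|Y]; first by rewrite -[LHS]scalar_mxM -scalerAl ee.
  rewrite [LHS]mul_scalar_mx; apply/matrixP => i j.
  rewrite [_ * _]/(_ *m _) !mxE (bigD1 j) //= big1 ?addr0 => [|k kj].
    by rewrite mxE eqxx -scalerAl -scalerAr ec.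
  by rewrite mxE (negbTE kj) mulr0.
have -> : X = \sum_t (coord (vbasis {:A}) t.2 (X t.1.1 t.1.2) *: e)%:M * g t.
  rewrite -[X in LHS]Xe -(proj2 (central_idempotent_scalar b ce)) [LHS]mul_scalar_mx.
  rewrite -(pair_bigA _ (fun (p : 'I_b * 'I_b) k =>
     (coord (vbasis {:A}) k (X p.1 p.2) *: e)%:M * g (p, k))) /=.
  have eX (Y : 'M[A]_b) : e *: Y = \sum_i \sum_j (e * Y i j) *: delta_mx i j.
    rewrite {1}[Y]matrix_sum_delta scaler_sumr; apply: eq_bigr => i _.
    by rewrite scaler_sumr; apply: eq_bigr => j _; rewrite scalerA.
  rewrite [LHS]eX (pair_bigA _ (fun i j => (e * X i j) *: delta_mx i j)) /=.
  apply: eq_bigr => -[i j] _ /=; apply/matrixP => p q; rewrite summxE !mxE.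
  rewrite {1}(coord_vbasis (memvf (X i j))) mulr_sumr mulr_suml.
  apply: eq_bigr => k _; rewrite [_ * g _]mul_scalar_mx mxE /g /=.
  rewrite [_ * _%:M]/(_ *m _) [in RHS]mxE (bigD1 q) //= big1 ?addr0; last first.
    by move=> l lq; rewrite [_%:M _ _]mxE (negbTE lq) mulr0.
  rewrite !mxE eqxx mulr1n; case: (_ && _); last by rewrite !mulr0 mul0r mulr0.
  by rewrite mulr1 mul1r -scalerAr -scalerAl.
apply: center_span_sum => [t|]; first exact: Kscal.
by have := Kscal 0; rewrite scale0r raddf0.
Qed.

Lemma matrix_corner_rep : (0 < b)%N -> e <> 0 ->
  exists (E : fieldType) m (phi : {rmorphism 'M[A]_b -> 'M[E]_m}),
    (0 < m)%N /\ phi e%:M = 1.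
Proof.
move=> b_gt0 e0; have [ee ec] := ce.
pose V : vectType F := {ffun 'I_b -> A}.
(* Matrices act on row vectors from the right, so composition keeps the order of products. The image
   of [e] is a subrepresentation, nonzero because the constant vector [e] is fixed. *)
pose act (X : 'M[A]_b) (v : V) : V := [ffun j => \sum_i v i * X i j].
have actL X : linear (act X).
  move=> c u v; apply/ffunP => j; rewrite !ffunE scaler_sumr -big_split /=.
  by apply: eq_bigr => i _; rewrite !ffunE mulrDl scalerAl.
have [rho rhoE] : exists rho : 'M[A]_b -> 'M[F]_(dim V),
    forall X v, v2r v *m rho X = v2r (act X v).
  have [rho rhoE] := choice (fun X => linear_map_mx (actL X)).
  by exists rho.
have mx_ext (M N : 'M[F]_(dim V)) : (forall v : V, v2r v *m M = v2r v *m N) -> M = N.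
  move=> H; apply/row_matrixP => i; rewrite !rowE.
  by have := H (r2v (delta_mx 0 i)); rewrite r2vK.
have [phi phiE] : exists phi : {rmorphism 'M[A]_b -> 'M[F]_(dim V)}, phi =1 rho.
  apply: rmorphism_exists; last split.
  - move=> X Y; apply: mx_ext => v; rewrite mulmxBr !rhoE -linearB; congr v2r.
    apply/ffunP => j; rewrite !ffunE -sumrB; apply: eq_bigr => i _.
    by rewrite !mxE mulrBr.
  - apply: mx_ext => v; rewrite rhoE [1]/(1%:M) mulmx1; congr v2r; apply/ffunP => j.
    rewrite ffunE (bigD1 j) //= mxE eqxx mulr1 big1 ?addr0 // => i ij.
    by rewrite mxE (negbTE ij) mulr0.
  - move=> X Y; apply: mx_ext => v; rewrite rhoE [_ * _]/(_ *m _) mulmxA !rhoE.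
    congr v2r; apply/ffunP => j; rewrite !ffunE.
    under eq_bigr do rewrite mxE mulr_sumr.
    rewrite exchange_big /=; apply: eq_bigr => k _; rewrite ffunE mulr_suml.
    by apply: eq_bigr => i _; rewrite mulrA.
have cE := central_idempotent_scalar b ce.
have [|phi' phi'E] := subrep (phi := phi) (W := phi e%:M).
  by move=> r; rewrite -[_ *m _]/(_ * _) -rmorphM (proj2 cE) rmorphM; apply: submxMl.
exists F, _, phi'; split; last first.
  by apply: phi'E; rewrite -[_ *m _]/(_ * _) -rmorphM (proj1 cE).
rewrite lt0n mxrank_eq0; apply/eqP => rho0.
pose v : V := [ffun=> e].
have := rhoE e%:M v; rewrite -phiE rho0 mulmx0 -(linear0 v2r).
move=> /(can_inj v2rK)/ffunP/(_ (Ordinal b_gt0)); rewrite !ffunE => /esym.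
rewrite (bigD1 (Ordinal b_gt0)) //= big1 => [|i ij]; last first.
  by rewrite mxE (negbTE ij) mulr0.
by rewrite ffunE mxE eqxx addr0 ee.
Qed.

Lemma matrix_splitting_exists : (0 < b)%N -> e <> 0 -> simple_corner e ->
  exists (E : fieldType) m (phi : {rmorphism 'M[A]_b -> 'M[E]_m}),
    (0 < m)%N /\ splitting e%:M phi.
Proof.
move=> b_gt0 e0 simple; apply: splitting_exists.
- exact: central_idempotent_scalar.
- exact: matrix_simple_corner.
- exact: matrix_center_span.
- exact: matrix_corner_rep.
Qed.

End SplittingMatrixAlgebra.

(** * Integrality and maximal orders *)

Section IntegralCoefficients.

Lemma splitting_field_exists n (E : fieldType) (f : {poly E}) :
  f \is monic -> (size f <= n.+1)%N ->
  exists (E' : fieldType) (iota : {rmorphism E -> E'}) (rs : seq E'),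
    map_poly iota f = \prod_(r <- rs) ('X - r%:P).
Proof.
elim: n E f => [|n IH] E f mf sf.
  exists E, idfun, [::]; rewrite big_nil map_poly_id //.
  have /size_poly1P [c _ fc] : size f == 1%N.
    by rewrite eqn_leq sf size_poly_gt0 monic_neq0.
  by move: mf; rewrite fc monicE lead_coefC => /eqP ->.
have [s1|s1] := leqP (size f) 1; first by apply: IH => //; apply: leq_trans s1 _.
have [E1 [iota [x /factor_theorem [g fg]]]] := root_extension s1.
have mg : g \is monic.
  by rewrite -(monicMr _ (monicXsubC x)) -fg map_monic.
have sg : (size g <= n.+1)%N.
  have : size (map_poly iota f) = size f by rewrite size_map_poly.
  by rewrite fg size_Mmonic ?monic_neq0 ?monicXsubC // size_XsubC addn2 /= => gE; rewrite -ltnS gE.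
have [E2 [iota2 [rs gE]]] := IH E1 g mg sg.
exists E2, (iota2 \o iota), (iota2 x :: rs).
by rewrite map_poly_comp fg rmorphM /= gE big_cons rmorphB /= map_polyX map_polyC mulrC.
Qed.

Variables (o : comNzRingType) (E : fieldType) (theta : {rmorphism o -> E}).

Lemma integral_coefs (f : {poly E}) : f \is monic ->
  (forall (E' : fieldType) (iota : {rmorphism E -> E'}) x,
     root (map_poly iota f) x -> integralOver (iota \o theta) x) ->
  forall j, integralOver theta f`_j.
Proof.
move=> mf rootint j.
have [E' [iota [rs fE]]] := splitting_field_exists mf (leqnSn _).
(* The relation descends from the splitting field of [f]: its coefficients come from [o], and [iota]
   is injective. *)
suff [p mp] : integralOver (iota \o theta) (iota f`_j).
  by rewrite map_poly_comp fmorph_root => rp; exists p.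
have {rootint} rootint r : r \in rs -> integralOver (iota \o theta) r.
  by move=> rrs; apply: rootint; rewrite fE root_prod_XsubC.
rewrite -coef_map fE {fE}.
elim: rs rootint j => [|r rs IH] rootint j.
  by rewrite big_nil coef1; apply: integral_nat.
have {}IH := IH (fun q qrs => rootint q (@mem_behead _ (r :: rs) q qrs)).
rewrite big_cons mulrBl coefB coefXM coefCM.
apply: integral_sub; first by case: eqP => _; [apply: integral0|apply: IH].
by apply: integral_mul; [apply: rootint; rewrite mem_head|apply: IH].
Qed.

End IntegralCoefficients.

Lemma scalar_rmorphism (R : nzRingType) (E : fieldType) m (f : R -> 'M[E]_m) :
  (0 < m)%N -> zmod_morphism f -> monoid_morphism f ->
  (forall x, is_scalar_mx (f x)) ->
  exists theta : {rmorphism R -> E}, forall x, f x = (theta x)%:M.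
Proof.
move=> m_gt0 fB [f1 fM] fsc; pose i0 := Ordinal m_gt0.
have fE x : f x = (f x i0 i0)%:M.
  by have /is_scalar_mxP [a ->] := fsc x; rewrite mxE eqxx.
have [theta thetaE] : exists theta : {rmorphism R -> E}, theta =1 fun x => f x i0 i0.
  apply: rmorphism_exists; last split.
  - by move=> x y; rewrite fB !mxE.
  - by rewrite f1 mxE eqxx.
  - move=> x y; have -> : f (x * y) = (f x i0 i0 * f y i0 i0)%:M.
      by rewrite fM [in LHS](fE x) [in LHS](fE y) scalar_mxM.
    by rewrite mxE eqxx.
by exists theta => x; rewrite thetaE -fE.
Qed.

Section Mspan.
Variables (R : pzRingType) (C S : set R).

Lemma mspan0 : mspan C S 0.
Proof. by exists 0%N, (fun=> 0), (fun=> 0); rewrite big_ord0; split=> // -[]. Qed.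

Lemma mspanM c s : C c -> S s -> mspan C S (c * s).
Proof. by move=> Cc Ss; exists 1%N, (fun=> c), (fun=> s); rewrite big_ord1. Qed.

Lemma mspanD x y : mspan C S x -> mspan C S y -> mspan C S (x + y).
Proof.
move=> [n [c [s [Cc Ss ->]]]] [n' [c' [s' [Cc' Ss' ->]]]].
exists (n + n')%N, (fun k => match fintype.split k with inl i => c i | inr j => c' j end),
  (fun k => match fintype.split k with inl i => s i | inr j => s' j end); split.
- by move=> k; case: fintype.split.
- by move=> k; case: fintype.split.
rewrite big_split_ord /=; congr (_ + _); apply: eq_bigr => i _.
  by rewrite (unsplitK (inl i)).
by rewrite (unsplitK (inr i)).
Qed.

Lemma mspan_ind (P : R -> Prop) : P 0 -> (forall x y, P x -> P y -> P (x + y)) ->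
  (forall c s, C c -> S s -> P (c * s)) -> forall x, mspan C S x -> P x.
Proof.
move=> P0 PD PM x [n [c [s [Cc Ss ->]]]].
by elim/big_ind: _ => // i _; apply: PM.
Qed.

End Mspan.

Section Orders.
Variables (o : idomainType) (A : falgType {fraction o}) (eps : A) (L : set A).
Hypotheses (ceps : central_idempotent eps) (ordL : is_order eps L).

Local Notation scal := (range (fun c : o => (tofrac c)%:A : A)).

Lemma order0 : L 0.
Proof. by have [_ [Le LB _] _ _] := ordL; rewrite -(subrr eps); apply: LB. Qed.

Lemma orderB x y : L x -> L y -> L (x - y).
Proof. by have [_ [_ LB _] _ _] := ordL; apply: LB. Qed.

Lemma orderN x : L x -> L (- x).
Proof. by rewrite -sub0r; apply/orderB/order0. Qed.

Lemma orderD x y : L x -> L y -> L (x + y).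
Proof. by move=> Lx Ly; rewrite -[y]opprK; apply/orderB/orderN. Qed.

Lemma orderM x y : L x -> L y -> L (x * y).
Proof. by have [_ [_ _ LM] _ _] := ordL; apply: LM. Qed.

Lemma order_sum (I : Type) (r : seq I) (P : pred I) (f : I -> A) :
  (forall i, P i -> L (f i)) -> L (\sum_(i <- r | P i) f i).
Proof. by move=> Lf; elim/big_ind: _ => //; [apply: order0|apply: orderD]. Qed.

Lemma order_sign n x : L x -> L ((-1) ^+ n * x).
Proof.
by move=> Lx; rewrite -signr_odd mulr_sign; case: odd => //; apply: orderN.
Qed.

Lemma order_unit x : L x -> x * eps = x.
Proof.
by have [Lc _ _ _] := ordL; move=> /Lc [y _ <-]; rewrite -mulrA (proj1 ceps).
Qed.

Lemma orderZ c x : L x -> L (tofrac c *: x).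
Proof.
have [_ _ [S [_ LE]] _] := ordL; rewrite LE.
move: x; apply: mspan_ind => [|x y|_ s [d _ <-] Ss].
- by rewrite scaler0; apply: mspan0.
- by rewrite scalerDr; apply: mspanD.
- rewrite scalerAl scalerA -rmorphM; apply: mspanM => //.
Qed.

End Orders.

(* Reduction modulo ['X * q] shows that [L[c]] is finitely generated, so it is
   an order. *)
Lemma maximal_order_integral (o : idomainType) (A : falgType {fraction o})
    (eps : A) (L : set A) (c : A) (q : {poly o}) :
  central_idempotent eps -> maximal_order eps L ->
  c * eps = c -> (forall x, c * x = x * c) -> q \is monic ->
  \sum_(i < size q) tofrac q`_i *: c ^+ i.+1 = 0 -> L c.
Proof.
move=> ceps [ordL maxL] ceq cc mq qc.
have [Lc [Le LB LM] [S [finS LS]] LF] := ordL.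
have cXc i x : c ^+ i * x = x * c ^+ i.
  elim: i => [|i IH]; first by rewrite !expr0 mulr1 mul1r.
  by rewrite exprS -mulrA IH mulrA cc mulrA.
pose L' : set A := ([set p.[c] | p in [set p : {poly A} | forall i, L p`_i]])%classic.
have LL' : (L `<=` L')%classic.
  move=> x Lx; exists x%:P; last by rewrite hornerC.
  by move=> i; rewrite coefC; case: eqP => // _; apply: order0 ordL.
pose d := (size q).-1.
have sq : size q = d.+1 by rewrite prednK // size_poly_gt0 monic_neq0.
(* The relation is [c * q(c) = 0] rather than [q(c) = 0], since [c ^+ 0] is 1 and not [eps]; hence
   its degree is [d.+1]. *)
have red i : c ^+ (d.+1 + i) = - \sum_(j < d) tofrac q`_j *: c ^+ (j.+1 + i).
  have := congr1 (fun z => z * c ^+ i) qc.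
  rewrite sq big_ord_recr /= mulrDl mul0r.
  have -> : q`_d = 1 by move: mq; rewrite monicE lead_coefE sq => /eqP.
  rewrite rmorph1 scale1r -exprD addrC => /eqP; rewrite addr_eq0 => /eqP ->.
  by rewrite mulr_suml; congr (- _); apply: eq_bigr => j _; rewrite -scalerAl exprD.
suff ordL' : is_order eps L'.
  rewrite -(maxL L' ordL' LL'); exists (eps%:P * 'X).
    move=> i; rewrite coefCM coefX; case: eqP => _; rewrite ?mulr1 ?mulr0 //.
    exact: order0 ordL.
  by rewrite hornerMX hornerC (proj2 ceps).
have L'eps x : L' x -> x * eps = x.
  move=> [p Lp <-]; rewrite horner_coef mulr_suml; apply: eq_bigr => i _.
  by rewrite -mulrA cXc mulrA (order_unit ceps ordL).
have L'mon l i : L l -> L' (l * c ^+ i).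
  move=> Ll; exists (l *: 'X^i); last by rewrite hornerZ hornerXn.
  move=> j; rewrite coefZ coefXn; case: eqP => _; rewrite ?mulr1 ?mulr0 //.
  exact: order0 ordL.
have L'B x y : L' x -> L' y -> L' (x - y).
  move=> [p Lp <-] [r Lr <-]; exists (p - r); last by rewrite hornerD hornerN.
  by move=> i; rewrite coefB; apply: LB.
split.
- by move=> x /L'eps <-; exists x.
- split; first exact: LL'.
  + exact: L'B.
  + move=> _ _ [p Lp <-] [r Lr <-]; exists (p * r).
      by move=> i; rewrite coefM; apply: (order_sum ordL) => j _; apply: LM.
    by rewrite hornerM_comm // /comm_poly horner_coef mulr_suml mulr_sumr;
      apply: eq_bigr => i _; rewrite cc -mulrA cXc // -exprS -exprSr cXc.
- pose S' : set A := (\bigcup_(i in `I_d.+1) [set s * c ^+ i | s in S])%classic.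
  exists S'; split.
    by apply: bigcup_finite => [|i _]; [apply: finite_II|apply: finite_image].
  have S'mon i l : L l ->
      mspan (range (fun c : o => (tofrac c)%:A)) S' (l * c ^+ i).
    have [n] := ubnP i; elim: n i l => // n IH i l; rewrite ltnS => lin Ll.
    have [id|di] := ltnP i d.+1.
      move: Ll; rewrite {1}LS; move: l; apply: mspan_ind => [|x y|a s Ca Ss].
      - by rewrite mul0r; apply: mspan0.
      - by rewrite mulrDl; apply: mspanD.
      - by rewrite -mulrA; apply: mspanM => //; exists i => //; exists s.
    rewrite -(subnKC di) red mulrN -mulNr mulr_sumr.
    elim/big_ind: _ => [|x y|j _]; [exact: mspan0|exact: mspanD|].
    rewrite -scalerAr scalerAl; apply: IH.
      by apply: leq_trans lin; rewrite -{2}(subnKC di) ltn_add2r ltnS.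
    by apply: (orderZ ordL); apply: (orderN ordL).
  apply/seteqP; split=> x.
    move=> [p Lp <-]; rewrite horner_coef.
    elim/big_ind: _ => [|y z|i _]; [exact: mspan0|exact: mspanD|exact: S'mon].
  move: x; apply: mspan_ind => [|x y L'x L'y|_ _ [a _ <-] [i _ [s Ss <-]]].
  + by apply: LL'; apply: order0 ordL.
  + rewrite -[y]opprK; apply: (L'B _ _) => //; rewrite -sub0r; apply: L'B => //.
    by apply: LL'; apply: order0 ordL.
  + by rewrite mulrA; apply: L'mon; rewrite LS; apply: mspanM => //; exists a.
- rewrite LF; apply/seteqP; split=> x.
    move: x; apply: mspan_ind => [|x y|a l Fa Ll]; [exact: mspan0|exact: mspanD|].
    by apply: mspanM => //; apply: LL'.
  rewrite -LF; move: x; apply: mspan_ind => [|x y|_ l [a _ <-] Ll].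
  + by exists 0; rewrite ?mul0r.
  + by move=> [x' _ <-] [y' _ <-]; exists (x' + y'); rewrite ?mulrDl.
  + by exists (a%:A * l) => //; rewrite -mulrA L'eps.
Qed.

Section OrderGenerators.
Variables (o : idomainType) (A : falgType {fraction o}) (L : set A).
Hypothesis ordL : is_order 1 L.

Lemma order_generators : exists s : seq A, (forall k, L s`_k) /\
  forall x, L x -> exists c : nat -> o,
    x = \sum_(k < size s) tofrac (c k) *: s`_k.
Proof.
have [_ _ [S [/finite_seqP [s ->] LS]] _] := ordL; exists s; split=> [k|x].
  have [lk|gk] := ltnP k (size s); last by rewrite nth_default //; apply: order0 ordL.
  rewrite LS -[s`_k]mul1r; apply: mspanM; last by rewrite /= mem_nth.
  by exists 1; rewrite // rmorph1 scale1r.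
rewrite {1}LS; move: x; apply: mspan_ind => [|x y [c ->] [d ->]|_ y [c _ <-] /= ys].
- by exists (fun=> 0); rewrite big1 // => k _; rewrite rmorph0 scale0r.
- exists (fun k => c k + d k); rewrite -big_split /=; apply: eq_bigr => k _.
  by rewrite rmorphD scalerDl.
- exists (fun k => if k == index y s then c else 0).
  have ly : (index y s < size s)%N by rewrite index_mem.
  rewrite (bigD1 (Ordinal ly)) //= eqxx nth_index // big1 ?addr0 ?mulr_algl //.
  move=> k; rewrite -val_eqE /= => /negbTE ->; by rewrite rmorph0 scale0r.
Qed.

Lemma mx_over_generators b : exists (T : finType) (g : T -> 'M[A]_b),
  (forall t, mx_over L (g t)) /\
  forall H, mx_over L H -> exists c : T -> o,
    H = \sum_t (tofrac (c t))%:A%:M *m g t.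
Proof.
have [s [Ls sL]] := order_generators.
pose g (p : 'I_b * 'I_b) (k : nat) : 'M[A]_b := \matrix_(i, j) (s`_k *+ ((i, j) == p)).
exists ('I_b * 'I_b * 'I_(size s))%type, (fun t => g t.1 (val t.2)); split.
  by move=> t i j; rewrite mxE; case: eqP => _; [apply: Ls|apply: order0 ordL].
move=> H LH.
have [c cE] := choice (fun p : 'I_b * 'I_b => sL _ (LH p.1 p.2)).
exists (fun t => c t.1 (val t.2)); apply/matrixP => i j; rewrite summxE.
rewrite -(pair_bigA _ (fun p (k : 'I_(size s)) =>
   ((tofrac (c p k))%:A%:M *m g p k) i j)) /=.
rewrite (bigD1 (i, j)) //= [X in _ + X]big1 ?addr0 => [|p pij]; last first.
  rewrite big1 // => k _; rewrite mul_scalar_mx !mxE eq_sym (negbTE pij).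
  by rewrite mulr0n mulr0.
rewrite [LHS](cE (i, j)); apply: eq_bigr => k _.
by rewrite mul_scalar_mx !mxE eqxx mulr_algl.
Qed.

Lemma mx_overM b (H H' : 'M[A]_b) : mx_over L H -> mx_over L H' -> mx_over L (H *m H').
Proof.
move=> LH LH' i j; rewrite mxE; apply: (order_sum ordL) => k _.
by apply: (orderM ordL).
Qed.

(** The determinant trick: multiplication by [H] on the [o]-generators [g] is given by a matrix [D]
    over [o]. A fixed coordinate of the vectors [v *m phi (g t)] gives an eigenvector of [D] for
    [x], so [x] is a root of the characteristic polynomial of [D]. *)
Lemma eigenvalue_integral b (E : fieldType) m (phi : {rmorphism 'M[A]_b -> 'M[E]_m})
    (theta : {rmorphism o -> E}) (H : 'M[A]_b) x :
  (forall c, phi (tofrac c)%:A%:M = (theta c)%:M) -> mx_over L H ->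
  eigenvalue (phi H) x -> integralOver theta x.
Proof.
move=> phitheta LH /eigenvalueP [v vH v0].
have [T [g [Lg gL]]] := mx_over_generators b.
have phig (c : T -> o) : phi (\sum_t (tofrac (c t))%:A%:M *m g t) =
    \sum_t theta (c t) *: phi (g t).
  rewrite rmorph_sum; apply: eq_bigr => t _.
  by rewrite -[_ *m _]/(_ * _) rmorphM phitheta [LHS]mul_scalar_mx.
have [C CE] := choice (fun t => gL _ (mx_overM LH (Lg t))).
have L1 : mx_over L (1%:M : 'M[A]_b).
  move=> i j; rewrite mxE; have [_ [L1 _ _] _ _] := ordL.
  by case: eqP => _; [|apply: order0 ordL].
have [d dE] := gL _ L1.
(* Since 1 is a combination of the [g t], not all [v *m phi (g t)] vanish; this provides the
   coordinate [i0]. *)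
have [t0 [i0 vt0]] : exists t i, (v *m phi (g t)) 0 i != 0.
  apply: contrapT => N; case/negP: v0; apply/eqP.
  rewrite -[v]mulmx1 -[1%:M]/(1 : 'M[E]_m) -(rmorph1 phi) [1 : 'M[A]_b]dE phig.
  rewrite mulmx_sumr big1 // => t _; rewrite -scalemxAr.
  suff -> : v *m phi (g t) = 0 by rewrite scaler0.
  apply/rowP => i; rewrite [RHS]mxE; apply: contrapT => /eqP vti.
  by apply: N; exists t, i.
pose D : 'M[o]_#|T| := \matrix_(j, k) C (enum_val k) (enum_val j).
pose y : 'rV[E]_#|T| := \row_k (v *m phi (g (enum_val k))) 0 i0.
have yD : y *m map_mx theta D = x *: y.
  apply/rowP => k; rewrite [LHS]mxE [RHS]mxE [y 0 k]mxE.
  have : v *m phi (H *m g (enum_val k)) = x *: (v *m phi (g (enum_val k))).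
    by rewrite -[H *m _]/(_ * _) rmorphM mulmxA vH scalemxAl.
  rewrite CE phig mulmx_sumr => /rowP/(_ i0); rewrite [RHS]mxE summxE => <-.
  rewrite (reindex (@enum_val T xpredT)) /=; last first.
    by apply: onW_bij; apply: enum_val_bij.
  apply: eq_bigr => j _; rewrite -scalemxAr [RHS]mxE mulrC.
  by rewrite [y _ _]mxE [map_mx _ _ _ _]mxE [D _ _]mxE.
have : eigenvalue (map_mx theta D) x.
  apply/eigenvalueP; exists y => //; apply/eqP => /rowP/(_ (enum_rank t0)).
  by rewrite [y _ _]mxE enum_rankK [RHS]mxE => /eqP; apply/negP.
rewrite eigenvalue_root_char -map_char_poly => rx.
by exists (char_poly D); first exact: char_poly_monic.
Qed.

End OrderGenerators.

(** For [m = 0] the basis in the splitting would be empty, and [e] would be an empty sum. *)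
Lemma splitting_dim_gt0 (R : pzRingType) (e : R) (E : fieldType) m
    (phi : {rmorphism R -> 'M[E]_m}) :
  central_idempotent e -> e <> 0 -> splitting e phi -> (0 < m)%N.
Proof.
move=> [ee _] e0 [_ _ [n [a [_ gen basis]]]]; case: m phi basis => // phi basis.
case: e0; have [|c [[_ ->] _]] := gen e; first by exists 1; rewrite ?mul1r.
have := size_basis basis; rewrite dimvf card_ord /dim /= mul0n => n0.
by subst n; rewrite big_ord0.
Qed.

Section RedcharIntegral.
Variables (o : idomainType) (A : falgType {fraction o}) (L : set A) (e : A).
Hypotheses (ordL : is_order 1 L) (ce : central_idempotent e) (e0 : e <> 0).
Hypothesis simple : simple_corner e.

Lemma scalar_zeta b z : zeta (corner [set: A]%classic e) z ->
  zeta (corner [set: 'M[A]_b]%classic e%:M) z%:M.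
Proof.
have cE := central_idempotent_scalar b ce.
move=> /(zeta_cornerP ce) [ze zc]; apply/(zeta_cornerP cE); split.
  by rewrite -[LHS]scalar_mxM ze.
move=> X; rewrite [LHS]mul_scalar_mx; apply/matrixP => i j.
rewrite [_ * _]/(_ *m _) !mxE (bigD1 j) //= big1 ?addr0 => [|k kj].
  by rewrite mxE eqxx zc.
by rewrite mxE (negbTE kj) mulr0.
Qed.

Lemma redchar_coef_integral b (H : 'M[A]_b) f j : (0 < b)%N -> mx_over L H ->
  is_redchar e (e *: H) f ->
  exists q : {poly o}, q \is monic /\
    \sum_(i < size q) tofrac q`_i *: f`_j ^+ i.+1 = 0.
Proof.
move=> b_gt0 LH [Kf [E [m [phi [splphi fphi]]]]].
have cE := central_idempotent_scalar b ce.
have m_gt0 : (0 < m)%N.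
  apply: splitting_dim_gt0 cE _ splphi => /matrixP/(_ (Ordinal b_gt0) (Ordinal b_gt0)).
  by rewrite !mxE eqxx.
have [phie Kscalar _] := splphi.
have phiscM x y : phi (x * y)%:M = phi x%:M * phi y%:M by rewrite scalar_mxM -rmorphM.
have phieM X : phi (e%:M * X) = phi X by rewrite rmorphM phie mul1r.
have [theta thetaE] : exists theta : {rmorphism o -> E},
    forall c, phi (tofrac c)%:A%:M = (theta c)%:M.
  apply: scalar_rmorphism => // [c d||c].
  - by rewrite rmorphB scalerBl raddfB rmorphB.
  - split=> [|c d]; first by rewrite rmorph1 scale1r rmorph1.
    by rewrite rmorphM -scalerA -mulr_algl scalar_mxM -rmorphM.
  - have -> : phi (tofrac c)%:A%:M = phi (tofrac c *: e)%:M.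
      by rewrite -phieM -[_ * _]scalar_mxM mulr_algr.
    apply/Kscalar/scalar_zeta.
    apply/(zeta_cornerP ce); split=> [|x]; first by rewrite -scalerAl (proj1 ce).
    by rewrite -scalerAl -scalerAr (proj2 ce).
have [q mq qx] : integralOver theta (char_poly (phi (e *: H)))`_j.
  apply: integral_coefs; first exact: char_poly_monic.
  move=> E' iota x; have [phi' phi'E] := extend_scalars iota phi.
  rewrite map_char_poly -eigenvalue_root_char.
  have -> : map_mx iota (phi (e *: H)) = phi' H.
    by rewrite phi'E /= -[phi H]phieM [_ * H]mul_scalar_mx.
  apply: (eigenvalue_integral ordL) LH => c.
  by rewrite phi'E /= thetaE map_scalar_mx.
exists q; split=> //.
have [fe fc] := (zeta_cornerP ce _).1 (Kf j).
(* One factor [f_j] is split off and [e] inserted, so that the cofactor is [q(f_j)] computed in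
   [A e], where [phi] is injective and maps the identity [e] to 1. *)
have -> : \sum_(i < size q) tofrac q`_i *: f`_j ^+ i.+1 =
    f`_j * \sum_(i < size q) tofrac q`_i *: (f`_j ^+ i * e).
  rewrite mulr_sumr; apply: eq_bigr => i _.
  by rewrite -scalerAr mulrA -exprS exprSr -mulrA fe.
suff -> : \sum_(i < size q) tofrac q`_i *: (f`_j ^+ i * e) = 0 by rewrite mulr0.
set w := \sum_(i < _) _.
suff : w%:M = 0 :> 'M[A]_b.
  by move=> /matrixP/(_ (Ordinal b_gt0) (Ordinal b_gt0)); rewrite !mxE eqxx.
apply: (simple_corner_rep_inj (phi := phi) (matrix_simple_corner ce simple) m_gt0 phie).
  rewrite -[LHS]scalar_mxM; congr _%:M; rewrite mulr_suml; apply: eq_bigr => i _.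
  by rewrite -scalerAl -mulrA (proj1 ce).
rewrite raddf_sum rmorph_sum.
transitivity (((map_poly theta q).[(char_poly (phi (e *: H)))`_j])%:M : 'M[E]_m).
  2: by move: qx => /rootP ->; rewrite raddf0.
rewrite horner_coef size_map_poly_id0; last first.
  by rewrite (monicP mq) rmorph1 oner_neq0.
rewrite raddf_sum. apply: eq_bigr => i _ /=.
have -> : tofrac q`_i *: (f`_j ^+ i * e) = (tofrac q`_i)%:A * (f`_j ^+ i * e).
  by rewrite mulr_algl.
rewrite phiscM thetaE coef_map scalar_mxM.
congr (_ *m _).
have -> : phi (f`_j ^+ i * e)%:M = phi (f`_j ^+ i)%:M.
  by rewrite -(proj2 ce) phiscM phie mul1r.
elim: (nat_of_ord i) => [|k IH]; first by rewrite !expr0 rmorph1.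
by rewrite !exprS phiscM scalar_mxM IH fphi.
Qed.

End RedcharIntegral.

(** * Matrix rings over commutative rings *)

Lemma char_poly_conj (E : fieldType) n (P Y : 'M[E]_n) :
  P \in unitmx -> char_poly (invmx P *m Y *m P) = char_poly Y.
Proof.
move=> Pu; pose c := map_mx (@polyC E) : 'M_n -> 'M_n.
have -> : char_poly (invmx P *m Y *m P) =
    \det (c (invmx P) *m char_poly_mx Y *m c P).
  congr (\det _); rewrite /char_poly_mx mulmxBr mulmxBl !map_mxM; congr (_ - _).
  by rewrite scalar_mxC -mulmxA -map_mxM mulVmx // map_mx1 mulmx1.
rewrite !det_mulmx mulrAC -det_mulmx -map_mxM mulVmx //.
by rewrite map_mx1 det1 mul1r.
Qed.

Section MatrixRepresentation.
Variables (G : comNzRingType) (E : fieldType) (N m : nat).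
Variables (Phi : {rmorphism 'M[G]_N -> 'M[E]_m}) (theta : {rmorphism G -> E}).
Hypotheses (m_gt0 : (0 < m)%N) (PhiE : forall g, Phi g%:M = (theta g)%:M).
Hypothesis full : forall M, espan Phi M.

(* The matrix units act on [E^m] as on a single copy of [E^N], because the image
   of [Phi] spans ['M[E]_m]. *)
Lemma matrix_rep_intertwiner : exists P : 'M[E]_(N, m),
  [/\ forall Y, P *m Phi Y = map_mx theta Y *m P, row_free P & row_full P].
Proof.
have PhiZ g Y : Phi (g *: Y) = theta g *: Phi Y.
  by rewrite -mul_scalar_mx [X in Phi X]/(_ * _) rmorphM PhiE [LHS]mul_scalar_mx.
have [s0 s0P] : exists s, Phi (delta_mx s s) != 0.
  apply: contrapT => none; have : Phi 1 = 0.
    rewrite [1]mx1_sum_delta rmorph_sum big1 // => s _; apply: contrapT => /eqP ns.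
    by apply: none; exists s.
  rewrite rmorph1 => /matrixP/(_ (Ordinal m_gt0) (Ordinal m_gt0)).
  by rewrite !mxE eqxx => /eqP; rewrite oner_eq0.
have [i wi] : exists i, row i (Phi (delta_mx s0 s0)) != 0.
  apply: contrapT => none; case/negP: s0P; apply/eqP/row_matrixP => i.
  by rewrite row0; apply: contrapT => /eqP ni; apply: none; exists i.
pose w := row i (Phi (delta_mx s0 s0)).
have wE : w *m Phi (delta_mx s0 s0) = w.
  by rewrite /w -row_mul -[_ *m _]/(_ * _) -rmorphM [_ * _]mul_delta_mx.
(* As [w] is fixed by the image of [E_(s0,s0)], the rows of [P] are permuted by matrix units like
   the standard basis of [E^N]. *)
pose P : 'M[E]_(N, m) := \matrix_s (w *m Phi (delta_mx s0 s)).
have PX Y : P *m Phi Y = map_mx theta Y *m P.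
  apply/row_matrixP => s; rewrite !row_mul rowK -mulmxA -[_ *m Phi Y]/(_ * _) -rmorphM.
  have -> : delta_mx s0 s * Y = \sum_t Y s t *: delta_mx s0 t.
    rewrite [LHS](_ : _ = delta_mx s0 0 *m row s Y); last first.
      by rewrite rowE mulmxA mul_delta_mx.
    rewrite [row s Y]row_sum_delta mulmx_sumr; apply: eq_bigr => t _.
    by rewrite -scalemxAr mul_delta_mx mxE.
  rewrite rmorph_sum mulmx_sumr [RHS]mulmx_sum_row; apply: eq_bigr => t _.
  by rewrite /= PhiZ -scalemxAr rowK !mxE.
have P0 : row s0 P = w by rewrite rowK.
have freeP : row_free P.
  rewrite -kermx_eq0; apply/rowV0P => y /sub_kermxP yP; apply/rowP => t.
  have : y *m (P *m Phi (delta_mx t s0)) = 0 by rewrite mulmxA yP mul0mx.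
  rewrite PX map_delta_mx mulmxA.
  have -> : y *m delta_mx t s0 = y 0 t *: delta_mx 0 s0.
    apply/rowP => j; rewrite !mxE (bigD1 t) //= big1 ?addr0 => [|k kt].
      by rewrite !mxE !eqxx.
    by rewrite mxE (negbTE kt) mulr0.
  rewrite -scalemxAl -rowE P0 => /eqP; rewrite scaler_eq0 (negbTE wi) orbF mxE.
  by move/eqP.
have fullP : row_full P.
  rewrite -sub1mx; apply/row_subP => j; set v := row j _.
  have [C wC] : exists C, w *m C = 1%:M.
    by apply/row_freeP; rewrite /row_free rank_rV wi.
  have -> : v = w *m (C *m v) by rewrite mulmxA wC mul1mx.
  rewrite -P0; apply: submx_trans (submxMr _ (row_sub _ _)) _.
  by apply: (espan_stable _ (full _)) => Y; rewrite PX submxMl.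
by exists P.
Qed.

End MatrixRepresentation.

(** An intertwiner that is both row free and row full forces [N = m] and is invertible, so [Phi X]
    is conjugate to the image of [X] under [theta]. *)
Lemma char_poly_matrix_rep (G : comNzRingType) (E : fieldType) N m
    (Phi : {rmorphism 'M[G]_N -> 'M[E]_m}) (theta : {rmorphism G -> E}) X :
  (0 < m)%N -> (forall g, Phi g%:M = (theta g)%:M) ->
  (forall M, espan Phi M) ->
  char_poly (Phi X) = map_poly theta (char_poly X).
Proof.
move=> m_gt0 PhiE full; rewrite map_char_poly.
have [P [PX freeP fullP]] := matrix_rep_intertwiner m_gt0 PhiE full.
have Nm : N = m by rewrite -(eqP freeP) (eqP fullP).
case: m / Nm Phi P PX freeP {PhiE full m_gt0 fullP} => Phi P PX Pfree.
have Punit : P \in unitmx by rewrite -row_free_unit.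
have -> : Phi X = invmx P *m map_mx theta X *m P by rewrite -mulmxA -PX mulKmx.
exact: char_poly_conj.
Qed.

Lemma order_zeta_central (o : idomainType) (A : falgType {fraction o}) (L : set A) x :
  is_order 1 L -> (forall y, L y -> x * y = y * x) -> forall y, x * y = y * x.
Proof.
move=> [_ _ _ LF] xc y.
have : corner setT 1 y by exists y => //; rewrite mulr1.
rewrite LF; move: y; apply: mspan_ind => [|y z yc zc|_ l [a _ <-] Ll].
- by rewrite mul0r mulr0.
- by rewrite mulrDl mulrDr yc zc.
- by rewrite mulr_algl -scalerAl -scalerAr xc.
Qed.

(** * Splittings restricted to a matrix ring component *)

Section MatrixRingComponent.
Variables (o : idomainType) (A : falgType {fraction o}) (L : set A) (eps : A).
Hypotheses (ordL : is_order 1 L) (ceps : central_idempotent eps).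
Variables (G : comNzRingType) (a : nat) (psi : {additive 'M[G]_a -> A}).
Hypothesis psiM : forall X Y, psi (X *m Y) = psi X * psi Y.
Hypothesis psiL : corner L eps = range psi.

(** [psi] is only additive and multiplicative; its value at 1 and [eps] are both identities of the
    corner. *)
Lemma matrix_ring_unit : psi 1%:M = eps.
Proof.
have [ee ec] := ceps.
have [Z _ Ze] : range psi eps.
  rewrite -psiL; exists 1; last by rewrite mul1r.
  by have [_ [L1 _ _] _ _] := ordL.
have [l _ lE] : corner L eps (psi 1%:M) by rewrite psiL; exists 1%:M.
have -> : psi 1%:M = psi 1%:M * eps by rewrite -lE -mulrA ee.
by rewrite -{1}Ze -psiM mul1mx.
Qed.

Lemma matrix_ring_eps X : psi X * eps = psi X.
Proof. by rewrite -matrix_ring_unit -psiM mulmx1. Qed.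

Lemma matrix_ring_scalar_central g x : psi g%:M * x = x * psi g%:M.
Proof.
move: x; apply: (order_zeta_central ordL) => l Ll.
have [Y _ Yl] : range psi (l * eps) by rewrite -psiL; exists l.
have -> : l * psi g%:M = l * eps * psi g%:M.
  by rewrite -mulrA (proj2 ceps) matrix_ring_eps.
rewrite -Yl -psiM scalar_mxC psiM Yl -(proj2 ceps).
by rewrite mulrA matrix_ring_eps.
Qed.

Variable b : nat.
Local Notation T := ('I_b * 'I_a)%type.

(* The identification of [M_(ba)(G)] with [M_b(L eps)], [L eps = M_a(G)]. *)
Definition blocks (X : 'M[G]_#|{: T}|) : 'M[A]_b :=
  \matrix_(i, j) psi (\matrix_(p, q) X (enum_rank (i, p)) (enum_rank (j, q))).

Lemma blocksB : {morph blocks : X Y / X - Y}.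
Proof.
move=> X Y; apply/matrixP => i j; rewrite !mxE -raddfB; congr (psi _).
by apply/matrixP => p q; rewrite !mxE.
Qed.

Lemma blocksM X Y : blocks (X *m Y) = blocks X *m blocks Y.
Proof.
apply/matrixP => i j; rewrite !mxE.
under eq_bigr do rewrite !mxE -psiM.
rewrite -raddf_sum; congr (psi _); apply/matrixP => p q; rewrite summxE !mxE.
rewrite (reindex (@enum_rank T)) /=; last by apply: onW_bij; apply: enum_rank_bij.
rewrite (eq_bigr (fun t => X (enum_rank (i, p)) (enum_rank (t.1, t.2)) *
  Y (enum_rank (t.1, t.2)) (enum_rank (j, q)))); last by case.
rewrite -(pair_bigA _ (fun k r => X (enum_rank (i, p)) (enum_rank (k, r)) *
  Y (enum_rank (k, r)) (enum_rank (j, q)))) /=.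
by apply: eq_bigr => k _; rewrite mxE; apply: eq_bigr => r _; rewrite !mxE.
Qed.

Lemma blocks_scalar g : blocks g%:M = (psi g%:M)%:M.
Proof.
apply/matrixP => i j; rewrite !mxE.
have -> : \matrix_(p, q) (g%:M : 'M_#|{: T}|) (enum_rank (i, p)) (enum_rank (j, q)) =
    if i == j then g%:M else 0 :> 'M_a.
  apply/matrixP => p q; rewrite mxE mxE (inj_eq enum_rank_inj) xpair_eqE.
  by case: eqP => _; rewrite ?mxE.
by case: eqP => _; rewrite ?raddf0.
Qed.

Lemma blocks_surj (H : 'M[A]_b) : mx_over L H -> exists X, blocks X = eps *: H.
Proof.
move=> LH.
have ex (ij : 'I_b * 'I_b) : exists Y, psi Y = eps * H ij.1 ij.2.
  have : corner L eps (H ij.1 ij.2 * eps) by exists (H ij.1 ij.2).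
  by rewrite psiL (proj2 ceps) => -[Y _ <-]; exists Y.
have [h hE] := choice ex.
exists (\matrix_(s, t) h ((enum_val s).1, (enum_val t).1) (enum_val s).2 (enum_val t).2).
apply/matrixP => i j; rewrite !mxE -(hE (i, j)); congr (psi _).
by apply/matrixP => p q; rewrite !mxE !enum_rankK.
Qed.

Section Component.
Variable e : A.
Hypotheses (ce : central_idempotent e) (e0 : e <> 0) (eeps : e * eps = e).
Hypotheses (simple : simple_corner e) (b_gt0 : (0 < b)%N).

Lemma matrix_ring_zeta g : zeta (corner setT e) (psi g%:M * e).
Proof.
apply/(zeta_cornerP ce); split=> [|x]; first by rewrite -mulrA (proj1 ce).
by rewrite -mulrA (proj2 ce x) mulrA (matrix_ring_scalar_central g x) mulrA.
Qed.

Section Splitting.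
Variables (E : fieldType) (m : nat) (phi : {rmorphism 'M[A]_b -> 'M[E]_m}).
Hypothesis splphi : splitting e%:M phi.

Let phie : phi e%:M = 1. Proof. by case: splphi. Qed.

Lemma splitting_scalarM X : phi (e *: X) = phi X.
Proof. by rewrite -mul_scalar_mx [X in phi X]/(_ * _) rmorphM phie mul1r. Qed.

Lemma splitting_eps : phi eps%:M = 1.
Proof.
have := phie; rewrite -{1}eeps scalar_mxM [X in phi X]/(_ * _) rmorphM phie mul1r.
by move->.
Qed.

Lemma splitting_epsM X : phi (eps *: X) = phi X.
Proof. by rewrite -mul_scalar_mx [X in phi X]/(_ * _) rmorphM splitting_eps mul1r. Qed.

Lemma splitting_dim : (0 < m)%N.
Proof.
apply: splitting_dim_gt0 (central_idempotent_scalar b ce) _ splphi.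
by move=> /matrixP/(_ (Ordinal b_gt0) (Ordinal b_gt0)); rewrite !mxE eqxx.
Qed.

(** The span of the image of [phi] is everything by the basis condition of a splitting; it remains
    to see that the matrices over [L eps] already span it over [E]. *)
Lemma matrix_ring_rep : exists (Phi : {rmorphism 'M[G]_#|{: T}| -> 'M[E]_m})
    (theta : {rmorphism G -> E}),
  [/\ Phi =1 phi \o blocks, forall g, phi (psi g%:M * e)%:M = (theta g)%:M,
      forall g, Phi g%:M = (theta g)%:M & forall M, espan Phi M].
Proof.
have [Phi PhiE] : exists Phi : {rmorphism 'M[G]_#|{: T}| -> 'M[E]_m},
    Phi =1 phi \o blocks.
  apply: rmorphism_exists; last split.
  - by move=> X Y /=; rewrite blocksB rmorphB.
  - by rewrite /= [1]/(1%:M) blocks_scalar matrix_ring_unit splitting_eps.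
  - by move=> X Y /=; rewrite blocksM -rmorphM.
have Phig g : Phi g%:M = phi (psi g%:M * e)%:M.
  rewrite PhiE /= blocks_scalar -splitting_scalarM; congr (phi _).
  by rewrite scale_scalar_mx (proj2 ce).
have Kscalar := let: And3 _ K _ := splphi in K.
have [theta thetaE] : exists theta : {rmorphism G -> E}, forall g, Phi g%:M = (theta g)%:M.
  apply: scalar_rmorphism; first exact: splitting_dim.
  - by move=> g h; rewrite raddfB rmorphB.
  - by split=> [|g h]; rewrite ?rmorph1 // scalar_mxM -rmorphM.
  - by move=> g; rewrite Phig; apply/Kscalar/scalar_zeta => //; apply: matrix_ring_zeta.
exists Phi, theta; split=> // [g|]; first by rewrite -Phig.
have spanx x i j : espan Phi (phi (x *: delta_mx i j)).
  have : corner setT 1 x by exists x => //; rewrite mulr1.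
  have [_ _ _ ->] := ordL; move: x; apply: mspan_ind => [|x y sx sy|_ l [c _ <-] Ll].
  - by rewrite scale0r rmorph0; apply: espan0.
  - by rewrite scalerDl rmorphD; apply: espanD.
  (* A scalar [c] of the fraction field acts through the central element [c *: e], which [phi] maps
     to a scalar matrix. *)
  - have -> : phi ((c%:A * l) *: delta_mx i j) =
        phi (c *: e)%:M * phi (eps *: (l *: delta_mx i j)).
      rewrite splitting_epsM -rmorphM -[LHS]splitting_scalarM; congr (phi _).
      by rewrite [RHS]mul_scalar_mx !scalerA mulr_algl -scalerAr scalerAl.
    have Kce : zeta (corner [set: A]%classic e) (c *: e).
      apply/(zeta_cornerP ce); split=> [|y]; first by rewrite -scalerAl (proj1 ce).
      by rewrite -scalerAl -scalerAr (proj2 ce).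
    have /is_scalar_mxP [d ->] := Kscalar _ (scalar_zeta ce b Kce).
    rewrite [_ * _]mul_scalar_mx; apply: espanZ.
    have [|X <-] := @blocks_surj (l *: delta_mx i j).
      move=> p q; rewrite !mxE; case: andb; rewrite ?mulr1 ?mulr0 //.
      exact: order0 ordL.
    by have := espan_im Phi X; rewrite PhiE.
have spanX X : espan Phi (phi X).
  rewrite [X]matrix_sum_delta rmorph_sum.
  elim/big_ind: _ => [|? ?|i _]; [exact: espan0|exact: espanD|].
  rewrite rmorph_sum.
  by elim/big_ind: _ => [|? ?|j _]; [exact: espan0|exact: espanD|].
move=> M; have [_ _ [n [al [_ _ /andP [/eqP spanA _]]]]] := splphi.
have : M \in <<[seq phi (al k) | k : 'I_n]>>%VS by rewrite spanA memvf.
move=> /(coord_span (X := in_tuple _)) ->.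
elim/big_ind: _ => [|? ?|i _]; [exact: espan0|exact: espanD|]; apply: espanZ.
have /fintype.imageP [k _ ->] : (in_tuple [seq phi (al k) | k : 'I_n])`_i \in
  [seq phi (al k) | k : 'I_n] by apply: mem_nth.
exact: spanX.
Qed.

End Splitting.
End Component.
End MatrixRingComponent.

(** * Reduced characteristic polynomials over matrix rings *)

Lemma scalar_mx_inj (R : nzRingType) b :
  (0 < b)%N -> injective (fun x : R => x%:M : 'M[R]_b).
Proof.
move=> b_gt0 x y /matrixP/(_ (Ordinal b_gt0) (Ordinal b_gt0)).
by rewrite !mxE eqxx.
Qed.

Lemma splitting_scalar_inj (A : nzRingType) (e : A) b (E : fieldType) m
    (phi : {rmorphism 'M[A]_b -> 'M[E]_m}) x y :
  central_idempotent e -> e <> 0 -> simple_corner e -> (0 < b)%N ->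
  splitting e%:M phi -> x * e = x -> y * e = y -> phi x%:M = phi y%:M -> x = y.
Proof.
move=> ce e0 simple b_gt0 splphi xe ye xy; have [phie _ _] := splphi.
have m_gt0 : (0 < m)%N.
  apply: splitting_dim_gt0 (central_idempotent_scalar b ce) _ splphi.
  by rewrite -(raddf0 (@scalar_mx A b)) => /(scalar_mx_inj b_gt0).
apply/eqP; rewrite -subr_eq0; apply/eqP/(scalar_mx_inj b_gt0); rewrite raddf0.
apply: (simple_corner_rep_inj (matrix_simple_corner ce simple) m_gt0 phie).
  by rewrite -[LHS]scalar_mxM mulrBl xe ye.
by rewrite raddfB rmorphB xy subrr.
Qed.

Section MatrixRingRedchar.
Variables (o : idomainType) (A : falgType {fraction o}) (L : set A) (eps : A).
Hypotheses (ordL : is_order 1 L) (ceps : central_idempotent eps).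
Variables (G : comNzRingType) (a : nat) (psi : {additive 'M[G]_a -> A}).
Hypothesis psiM : forall X Y, psi (X *m Y) = psi X * psi Y.
Hypothesis psiL : corner L eps = range psi.
Variables (e : A) (b : nat).
Hypotheses (ce : central_idempotent e) (e0 : e <> 0) (eeps : e * eps = e).
Hypotheses (simple : simple_corner e) (b_gt0 : (0 < b)%N).
Variables (H : 'M[A]_b) (X : 'M[G]_#|{: 'I_b * 'I_a}|).
Hypothesis XH : blocks psi X = eps *: H.

(** A constructed splitting shows that a reduced characteristic polynomial exists. The chosen one
    may come from another splitting, where the same formula holds, and injectivity on [A e]
    identifies the coefficients. *)
Lemma matrix_ring_redchar k :
  (redchar e (e *: H))`_k = psi ((char_poly X)`_k)%:M * e.
Proof.
have chE (E : fieldType) m (phi : {rmorphism 'M[A]_b -> 'M[E]_m}) : splitting e%:M phi ->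
    forall k, ((char_poly (phi (e *: H)))`_k)%:M = phi (psi ((char_poly X)`_k)%:M * e)%:M.
  move=> splphi j; have m_gt0 := splitting_dim ce e0 b_gt0 splphi.
  have [Phi [theta [PhiE phitheta Phitheta full]]] :=
    matrix_ring_rep ordL ceps psiM psiL ce e0 eeps b_gt0 splphi.
  have -> : phi (e *: H) = Phi X.
    by rewrite PhiE /= XH (splitting_scalarM splphi) (splitting_epsM eeps splphi).
  by rewrite (char_poly_matrix_rep _ m_gt0 Phitheta full) coef_map phitheta.
have zE g := matrix_ring_zeta ordL ceps psiM psiL ce g.
have /xgetPex : exists f, is_redchar e (e *: H) f.
  have [E [m [phi [m_gt0 splphi]]]] := matrix_splitting_exists ce b_gt0 e0 simple.
  have fE j : (\poly_(i < size (char_poly X)) (psi ((char_poly X)`_i)%:M * e))`_j =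
      psi ((char_poly X)`_j)%:M * e.
    rewrite coef_poly; have [//|lej] := ltnP j (size (char_poly X)).
    by rewrite nth_default // !raddf0 mul0r.
  exists (\poly_(i < size (char_poly X)) (psi ((char_poly X)`_i)%:M * e)).
  split=> [j|]; first by rewrite fE; apply: zE.
  by exists E, m, phi; split=> // j; rewrite fE chE.
move=> /(_ 0) [Kf [E [m [phi [splphi fphi]]]]].
apply: (splitting_scalar_inj ce e0 simple b_gt0 splphi).
- by have /(zeta_cornerP ce) [] := Kf k.
- by rewrite -mulrA (proj1 ce).
- by rewrite fphi chE.
Qed.

(** The leading coefficient is [eps * e = e], which is nonzero. The degree is the same for all [e]
    below [eps], so the signs agree when components are added. *)
Lemma matrix_ring_size_redchar :
  (size (redchar e (e *: H))).-1 = #|{: 'I_b * 'I_a}|.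
Proof.
set N := #|_|; suff -> : size (redchar e (e *: H)) = N.+1 by [].
apply/eqP; rewrite eqn_leq; apply/andP; split.
  apply/leq_sizeP => j Nj; rewrite matrix_ring_redchar nth_default ?size_char_poly //.
  by rewrite !raddf0 mul0r.
rewrite ltnNge; apply/negP => /leq_sizeP/(_ N (leqnn _)).
have := char_poly_monic X; rewrite matrix_ring_redchar monicE lead_coefE size_char_poly.
by move=> /eqP ->; rewrite (matrix_ring_unit ordL ceps psiM psiL) -(proj2 ce) eeps.
Qed.

End MatrixRingRedchar.

(** * Reduced norms and adjoints over nice orders *)

(** The factor [c] absorbs every [e]. Powers of [e *: H] become powers of [H], which stay over [L]
    even if [e] is not in [L]. *)
Lemma scale_corner_exp (A : nzRingType) (e c : A) b (H : 'M[A]_b) k :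
  central_idempotent e -> c * e = c -> c *: (e *: H) ^+ k = c *: H ^+ k.
Proof.
move=> ce cE; elim: k => [|k IH]; first by rewrite !expr0.
rewrite !exprSr [LHS]scalemxAl IH -[RHS]/(c *: (_ *m _)) -[LHS]scalemxAl.
suff -> : H ^+ k *m (e *: H) = e *: (H ^+ k *m H) by rewrite scalerA cE.
rewrite -mul_scalar_mx mulmxA -[_ *m e%:M]/(_ * _).
by rewrite -(proj2 (central_idempotent_scalar b ce)) [e%:M * _]mul_scalar_mx -scalemxAl.
Qed.

Lemma nr_cpi (A : nzRingType) (es : seq A) b (H : 'M[A]_b) : uniq es ->
  (forall e, central_primitive_idempotent e <-> e \in es) ->
  nr H = \sum_(e <- es) nr_comp e H /\ adjoint H = \sum_(e <- es) adjoint_comp e H.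
Proof.
move=> ues es_cpi; rewrite /nr /adjoint.
have -> : [set e : A | central_primitive_idempotent e]%classic = [set` es]%classic.
  by apply/seteqP; split=> e /=; apply es_cpi.
by rewrite -!fsbig_seq.
Qed.

Lemma redchar_zeta (A : nzRingType) (e : A) b (H : 'M[A]_b) k :
  central_idempotent e -> zeta (corner setT e) (redchar e (e *: H))`_k.
Proof.
move=> ce; have [ex|nex] := pselect (exists f, is_redchar e (e *: H) f).
  by have [Kf _] := xgetPex 0 ex; apply: Kf.
(* The default value of the choice is the zero polynomial. *)
rewrite /redchar xgetPN => [|f fH]; last by apply: nex; exists f.
by rewrite coef0; apply/(zeta_cornerP ce); split=> [|x]; rewrite ?mul0r ?mulr0.
Qed.

Lemma nr_comp_central (A : nzRingType) (e : A) b (H : 'M[A]_b) x :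
  central_idempotent e -> nr_comp e H * x = x * nr_comp e H.
Proof.
move=> ce; have /(zeta_cornerP ce) [_ fc] := redchar_zeta H 0 ce.
by rewrite /nr_comp -signr_odd !mulr_sign; case: odd; rewrite ?mulNr ?mulrN fc.
Qed.

Lemma nr_comp_one (F : fieldType) (A : falgType F) (e : A) :
  central_idempotent e -> e <> 0 -> simple_corner e ->
  nr_comp e (1%:M : 'M[A]_1) = e.
Proof.
move=> ce e0 simple; have [ee ec] := ce; pose p m : {poly int} := ('X - 1) ^+ m.
have chE (E : fieldType) m : char_poly (1%:M : 'M[E]_m) = map_poly intr (p m).
  rewrite /p rmorphXn rmorphB /= map_polyX [map_poly intr 1]rmorph1 /char_poly /char_poly_mx.
  by rewrite map_mx1 -raddfB det_scalar.
pose f m k : A := ((p m)`_k)%:~R * e.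
have sc (R : nzRingType) k (n : int) : (n%:~R)%:M = n%:~R :> 'M[R]_k.
  exact: (raddfMz (@scalar_mx R k) n 1).
have fe m k : f m k * e = f m k by rewrite /f -mulrA ee.
have chphi (E : fieldType) m (phi : {rmorphism 'M[A]_1 -> 'M[E]_m}) :
    splitting e%:M phi -> forall k,
    ((char_poly (phi (e *: 1%:M)))`_k)%:M = phi (f m k)%:M.
  move=> [phie _ _] k; rewrite scale_scalar_mx mulr1 phie chE coef_map /=.
  rewrite /f scalar_mxM [X in phi X]/(_ * _) rmorphM phie mulr1.
  by rewrite !sc rmorph_int.
have fz m k : zeta (corner setT e) (f m k).
  by apply/(zeta_cornerP ce); split=> [//|x]; rewrite /f mulrzl mulrzAl mulrzAr ec.
have ex : exists g, is_redchar e (e *: (1%:M : 'M[A]_1)) g.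
  have [E [m [phi [m_gt0 splphi]]]] := matrix_splitting_exists ce (ltn0Sn 0) e0 simple.
  have fE k : (\poly_(i < m.+1) f m i)`_k = f m k.
    rewrite coef_poly; have [//|lek] := ltnP k m.+1.
    rewrite /f nth_default ?mul0r // /p -polyC1 size_exp_XsubC; exact: lek.
  exists (\poly_(i < m.+1) f m i); split=> [k|]; first by rewrite fE; apply: fz.
  by exists E, m, phi; split=> // k; rewrite fE chphi.
have := xgetPex 0 ex; rewrite -/(redchar e (e *: 1%:M)).
set g := redchar _ _ => -[Kf [E [m [phi [splphi fphi]]]]].
have gE k : g`_k = f m k.
  apply: (splitting_scalar_inj ce e0 simple (ltn0Sn 0) splphi) => //.
    by have /(zeta_cornerP ce) [] := Kf k.
  by rewrite fphi chphi.
have pm : (p m)`_m = 1.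
  have := monic_exp m (monicXsubC (1 : int)).
  by rewrite monicE lead_coefE size_exp_XsubC polyC1 => /eqP.
have sg : size g = m.+1.
  apply/eqP; rewrite eqn_leq; apply/andP; split.
    apply/leq_sizeP => k mk; rewrite gE /f nth_default ?mul0r //.
    by rewrite /p -polyC1 size_exp_XsubC.
  rewrite ltnNge; apply/negP => /leq_sizeP/(_ m (leqnn _)).
  by rewrite gE /f pm mul1r.
rewrite /nr_comp -/g sg gE /f /=.
have -> : (p m)`_0 = (-1) ^+ m.
  by rewrite -horner_coef0 /p -polyC1 horner_exp hornerXsubC sub0r.
by rewrite rmorphXn rmorphN1 signrMK.
Qed.

Section Components.
Variables (o : idomainType) (A : falgType {fraction o}) (L : set A) (eps : A).
Hypotheses (ordL : is_order 1 L) (ceps : central_idempotent eps) (Leps : L eps).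
Variables (b : nat) (H : 'M[A]_b).
Hypotheses (b_gt0 : (0 < b)%N) (LH : mx_over L H).

Lemma corner_sub_order x : corner L eps x -> L x.
Proof. by move=> [l Ll <-]; apply: (orderM ordL). Qed.

Lemma mx_overX k : mx_over L (H ^+ k).
Proof.
elim: k => [|k IH]; last by rewrite exprSr; apply: mx_overM.
move=> i j; rewrite mxE; have [_ [L1 _ _] _ _] := ordL.
by case: eqP => _; [|apply: order0 ordL].
Qed.

Lemma mx_over_sign n (M : 'M[A]_b) : mx_over L M -> mx_over L ((-1) ^+ n *: M).
Proof. by move=> LM i j; rewrite mxE; apply: (order_sign ordL). Qed.

Lemma mx_over_sum (I : Type) (r : seq I) (P : pred I) (f : I -> 'M[A]_b) :
  (forall i, P i -> mx_over L (f i)) -> mx_over L (\sum_(i <- r | P i) f i).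
Proof. by move=> Lf i j; rewrite summxE; apply: (order_sum ordL) => k Pk; apply: Lf. Qed.

Lemma adjoint_compE e : central_idempotent e ->
  adjoint_comp e H = let f := redchar e (e *: H) in
    (-1) ^+ (size f).-1.+1 *: \sum_(1 <= j < (size f).-1.+1) f`_j *: H ^+ j.-1.
Proof.
move=> ce; rewrite /adjoint_comp /=; congr (_ *: _); apply: eq_bigr => j _.
apply: scale_corner_exp => //.
by have /(zeta_cornerP ce) [] := redchar_zeta H j ce.
Qed.

Lemma maximal_component e : maximal_order eps (corner L eps) ->
  central_idempotent e -> e <> 0 -> simple_corner e -> e * eps = e ->
  L (nr_comp e H) /\ mx_over L (adjoint_comp e H).
Proof.
move=> maxL ce e0 simple eeps.
have Lf k : L (redchar e (e *: H))`_k.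
  have [ex|nex] := pselect (exists f, is_redchar e (e *: H) f); last first.
    rewrite /redchar xgetPN => [|f fH]; last by apply: nex; exists f.
    by rewrite coef0; apply: order0 ordL.
  have [q [mq qc]] := redchar_coef_integral ordL ce e0 simple k b_gt0 LH (xgetPex 0 ex).
  apply: corner_sub_order; apply: (maximal_order_integral ceps maxL _ _ mq qc).
    have /(zeta_cornerP ce) [fe _] := redchar_zeta H k ce.
    by rewrite -[X in X * eps]fe -mulrA eeps fe.
  by have /(zeta_cornerP ce) [] := redchar_zeta H k ce.
split; first by apply: (order_sign ordL).
rewrite adjoint_compE //; apply/mx_over_sign/mx_over_sum => j _ p q.
by rewrite mxE; apply: (orderM ordL) => //; apply: mx_overX.
Qed.

(** A single [e] need not lie in [L], and neither need the coefficients [e * c k]; their sum over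
    all [e] below [eps] is [eps * c k = c k], which does. *)
Lemma matrix_ring_component (G : comNzRingType) a (psi : {additive 'M[G]_a -> A})
    (es : seq A) :
  (forall X Y, psi (X *m Y) = psi X * psi Y) -> corner L eps = range psi ->
  (forall e, e \in es -> [/\ central_idempotent e, e <> 0, simple_corner e & e * eps = e]) ->
  \sum_(e <- es) e = eps ->
  L (\sum_(e <- es) nr_comp e H) /\ mx_over L (\sum_(e <- es) adjoint_comp e H).
Proof.
move=> psiM psiL esP sum_es.
have [X XH] := blocks_surj ceps psiL LH.
pose c k := psi ((char_poly X)`_k)%:M; pose N := #|{: 'I_b * 'I_a}|.
have Lc k : L (c k) by apply: corner_sub_order; rewrite psiL; exists ((char_poly X)`_k)%:M.
have ceq k : eps * c k = c k.
  by rewrite (proj2 ceps) (matrix_ring_eps ordL ceps psiM psiL).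
have coefE e k : e \in es -> (redchar e (e *: H))`_k = e * c k.
  move=> /esP [ce e0 simple eeps].
  rewrite (matrix_ring_redchar ordL ceps psiM psiL ce e0 eeps simple b_gt0 XH).
  by rewrite (proj2 ce).
have sizeE e : e \in es -> (size (redchar e (e *: H))).-1 = N.
  move=> /esP [ce e0 simple eeps].
  by rewrite (matrix_ring_size_redchar ordL ceps psiM psiL ce e0 eeps simple b_gt0 XH).
split.
  have -> : \sum_(e <- es) nr_comp e H = (-1) ^+ N * c 0%N.
    rewrite -ceq -sum_es mulr_suml mulr_sumr; apply: eq_big_seq => e ees.
    by rewrite /nr_comp sizeE // coefE.
  by apply: (order_sign ordL).
have -> : \sum_(e <- es) adjoint_comp e H =
    (-1) ^+ N.+1 *: \sum_(1 <= j < N.+1) c j *: H ^+ j.-1.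
  rewrite (eq_bigr (fun j => eps *: (c j *: H ^+ j.-1))); last first.
    by move=> j _; rewrite scalerA ceq.
  rewrite -scaler_sumr -sum_es scaler_suml scaler_sumr.
  apply: eq_big_seq => e ees; have [ce _ _ _] := esP e ees.
  rewrite adjoint_compE //= sizeE //; congr (_ *: _); rewrite scaler_sumr.
  by apply: eq_bigr => j _; rewrite coefE // scalerA.
apply/mx_over_sign/mx_over_sum => j _ p q.
by rewrite mxE; apply: (orderM ordL) => //; apply: mx_overX.
Qed.

End Components.

(** * Assembling the components of a nice order *)

Section NiceOrder.
Variables (o : idomainType) (A : falgType {fraction o}) (L : set A).
Hypothesis niceL : nice L.

Let ordL : is_order 1 L. Proof. by case: niceL => -[]. Qed.

Let ssA : semisimple_algebra A. Proof. by case: niceL => -[_ []]. Qed.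

Lemma nice_nr_adjoint b (H : 'M[A]_b) : (0 < b)%N -> mx_over L H ->
  zeta L (nr H) /\ mx_over L (adjoint H).
Proof.
move=> b_gt0 LH; have [_ [k [eps [zeps orth sum1 comps]]]] := niceL.
have ceps j : central_idempotent (eps j).
  have [[_ epsc] epse] := zeps j; split=> // x.
  exact: order_zeta_central ordL epsc x.
have [es [ues sum_es es_cpi es_orth]] := cpi_list A.
have [-> ->] := nr_cpi H ues es_cpi.
have ce e : e \in es -> central_idempotent e by move=> /es_cpi [].
(* As the [eps j] sum to 1, some [e * eps j] is nonzero and then equals [e] by primitivity;
   orthogonality makes [j] unique. *)
have e_eps e : e \in es -> exists j, forall i, (e * eps i == e) = (i == j).
  move=> ees; have pe := (es_cpi e).2 ees; have [_ e0 _] := pe.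
  have [j ej] : exists j, e * eps j <> 0.
    apply: contrapT => none; apply: e0; rewrite -[e]mulr1 -sum1 mulr_sumr big1 // => j _.
    by apply: contrapT => ej; apply: none; exists j.
  have eE := cpi_absorb pe (ceps j) ej; exists j => i.
  have [->|ij] := eqVneq i j; first by rewrite eE eqxx.
  apply/eqP => eiE; apply: e0; rewrite -eE -eiE -mulrA orth // mulr0 //.
have split_sum (V : nmodType) (x : A -> V) :
    \sum_(e <- es) x e = \sum_j \sum_(e <- [seq e <- es | e * eps j == e]) x e.
  under [RHS]eq_bigr do rewrite big_filter.
  rewrite (exchange_big_dep xpredT) //= [LHS]big_seq [RHS]big_seq.
  apply: eq_bigr => e /e_eps [j ej].
  by rewrite (eq_bigl (pred1 j)) ?big_pred1_eq // => i; rewrite ej.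
have comp j : L (\sum_(e <- [seq e <- es | e * eps j == e]) nr_comp e H) /\
    mx_over L (\sum_(e <- [seq e <- es | e * eps j == e]) adjoint_comp e H).
  have fP e : e \in [seq e <- es | e * eps j == e] ->
      [/\ central_idempotent e, e <> 0, simple_corner e & e * eps j = e].
    rewrite mem_filter => /andP [/eqP eeps ees].
    have pe := (es_cpi e).2 ees; have [? ? _] := pe.
    by split=> //; apply: cpi_simple.
  have [Leps _] := (zeps j).1.
  have [maxj|[G [a [psi [a_gt0 _ psiM psiL]]]]] := comps j.
    rewrite !big_seq; split.
      apply: (order_sum ordL) => e /fP [cen e0 simple eeps].
      by have [] := maximal_component ordL (ceps j) Leps b_gt0 LH maxj cen e0 simple eeps.
    apply: (mx_over_sum ordL) => e /fP [cen e0 simple eeps].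
    by have [] := maximal_component ordL (ceps j) Leps b_gt0 LH maxj cen e0 simple eeps.
  (* Multiply the sum of all [e] by [eps j]: each [e] is either kept or annihilated. *)
  have sum_eps : \sum_(e <- [seq e <- es | e * eps j == e]) e = eps j.
    rewrite -[RHS]mul1r -sum_es mulr_suml [RHS](bigID (fun e => e * eps j == e)) /=.
    rewrite [X in _ + X]big_seq_cond [X in _ + X]big1 => [|e /andP [ees eN]]; last first.
      apply: contrapT => e0; case/negP: eN; apply/eqP.
      by apply: cpi_absorb e0 => //; apply/es_cpi.
    by rewrite addr0 big_filter; apply: eq_bigr => e /eqP.
  (* The commutative ring in [is_matrix_ring] may be zero; then [eps j = 0] and no [e] lies below
     it. Otherwise [G'] is [G] with its nontriviality recorded. *)
  have [G0|G1] := pselect ((1 : G) = 0).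
    have epsj0 : eps j = 0.
      have [Z _ <-] : range psi (eps j).
        by rewrite -psiL; exists (eps j); rewrite ?(proj1 (ceps j)).
      suff -> : Z = 0 by rewrite raddf0.
      by apply/matrixP => p q; rewrite -[Z p q]mul1r G0 mul0r mxE.
    rewrite (_ : [seq e <- es | e * eps j == e] = [::]).
      by rewrite !big_nil; split=> [|p q]; rewrite ?mxE; apply: order0 ordL.
    apply/eqP; rewrite -size_eq0 size_filter -leqn0 leqNgt -has_count; apply/hasPn => e ees.
    rewrite epsj0 mulr0 eq_sym; apply/eqP.
    by have [] := (es_cpi e).2 ees.
  have G1' : (1 : G) != 0 by apply/eqP.
  pose mG := GRing.PzSemiRing_isNonZero.Build G G1'.
  pose G' : comNzRingType := HB.pack G mG.
  exact: (@matrix_ring_component _ _ _ _ ordL (ceps j) Leps _ _ b_gt0 LH G' a psi _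
            psiM psiL fP sum_eps).
split; last by rewrite split_sum; apply: (mx_over_sum ordL) => j _; case: (comp j).
split; first by rewrite split_sum; apply: (order_sum ordL) => j _; case: (comp j).
move=> y _; rewrite mulr_suml mulr_sumr; apply: eq_big_seq => e /ce cen.
exact: nr_comp_central.
Qed.

Lemma nr_one : nr (1%:M : 'M[A]_1) = 1.
Proof.
have [es [ues sum_es es_cpi es_orth]] := cpi_list A.
have [-> _] := nr_cpi (1%:M : 'M[A]_1) ues es_cpi.
rewrite -[RHS]sum_es; apply: eq_big_seq => e /es_cpi pe; have [? ? _] := pe.
by apply: nr_comp_one => //; apply: cpi_simple.
Qed.

End NiceOrder.

Theorem proposition4p3 (o : idomainType) (A : falgType {fraction o})
    (Lambda : set A) (hLambda : nice Lambda) :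
  calU Lambda = calI Lambda /\ calI Lambda = calH Lambda /\
  calH Lambda = zeta Lambda.
Proof.
have ordL : is_order 1 Lambda by case: hLambda => -[].
have [_ [L1 _ _] _ _] := ordL.
have UI : (calU Lambda `<=` calI Lambda)%classic.
  move=> x; apply: mspan_ind => [||c _ zc [b [H [b0 [LH _] ->]]]].
  - exact: mspan0.
  - exact: mspanD.
  - by apply: mspanM => //; exists b, H.
have IZ : (calI Lambda `<=` zeta Lambda)%classic.
  move=> x; apply: mspan_ind => [|u v [Lu uc] [Lv vc]|c _ [Lc cc] [b [H [b0 LH ->]]]].
  - by split=> [|y]; [apply: order0 ordL|rewrite mul0r mulr0].
  - split=> [|y Ly]; first by apply: (orderD ordL).
    by rewrite mulrDl mulrDr uc ?vc.
  - have [[Ln nc] _] := nice_nr_adjoint hLambda b0 LH.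
    split=> [|y Ly]; first by apply: (orderM ordL).
    by rewrite -mulrA nc // mulrA (cc y) // -mulrA.
have ZU : (zeta Lambda `<=` calU Lambda)%classic.
  move=> x zx; rewrite -[x]mulr1 -(nr_one hLambda); apply: mspanM => //.
  exists 1%N, 1%:M; split=> //.
  have over1 : mx_over Lambda (1%:M : 'M[A]_1).
    by move=> i j; rewrite mxE; case: eqP => _; [|apply: order0 ordL].
  by split=> //; exists 1%:M; rewrite mulmx1.
have HZ : calH Lambda = zeta Lambda.
  apply/seteqP; split=> x; first by case.
  move=> zx; split=> // b H b0 LH i j; rewrite mxE; apply: (orderM ordL).
    by case: zx.
  by have [_] := nice_nr_adjoint hLambda b0 LH; apply.
have UZ : calU Lambda = zeta Lambda.
  by apply/seteqP; split=> //; apply: subset_trans IZ.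
have IE : calI Lambda = zeta Lambda.
  by apply/seteqP; split=> //; apply: subset_trans UI.
by rewrite UZ IE HZ.
Qed.
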